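(* Let $n\ge 1$ be an integer and let $\eta_n:\widehat{\mathcal T}\to(1,+\infty)$ be the map $$\eta_n\big((k_1,k_2,\dots,k_r,\dots)\big)=\lim_{r\to+\infty}T_n(k_1,k_2,\dots,k_r).$$ Then: (i) $\eta_n(\widehat{\mathcal T}\setminus\widehat{\mathcal T}^{R})=\left(1,e^{1+\frac12+\cdots+\frac1n}\right]$, $\ \eta_n(\widehat{\mathcal T}^{R})\subseteq\left(1,e^{1+\frac12+\cdots+\frac1n}\right)$, and $\eta_n\big((1,1,\dots,1,\dots)\big)=e^{1+\frac12+\cdots+\frac1n}$. (ii) For all $\mathbf k,\mathbf l\in\widehat{\mathcal T}_2$, we have $\eta_n(\mathbf k)>\eta_n(\mathbf l)$ if and only if $\mathbf k\succ\mathbf l$. (iii) The Hausdorff dimension of $\eta_n(\widehat{\mathcal T}_2)\subseteq\mathbb R$ is $$\dim_{\mathrm H}\eta_n(\widehat{\mathcal T}_2)=\frac{\log\frac{1+\sqrt5}{2}}{\log 2}.$$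
   Context: $\mathbb N$ denotes the positive integers. For integers $n,r\ge1$ and $k_1,\dots,k_r\ge 1$, with $K_i=k_1+\cdots+k_i$, define the rational number $$T_n(k_1,\dots,k_r)=\int_{[0,1]^{K_r}}\prod_{i=1}^{r}\Big[1+(x_1\cdots x_{K_i})+(x_1\cdots x_{K_i})^2+\cdots+(x_1\cdots x_{K_i})^n\Big]\,dx_1\cdots dx_{K_r}.$$ Define the sets of infinite sequences $\widehat{\mathcal T}=\{(k_1,k_2,\dots): k_i\in\mathbb N,\ k_i\ge1 \text{ for all } i\ge 1\}$; $\widehat{\mathcal T}_2=\{(k_1,k_2,\dots): k_i\in\mathbb N,\ k_i\ge 2 \text{ for all } i\ge1\}$; $\widehat{\mathcal T}^{R}=\{(k_1,k_2,\dots)\in\widehat{\mathcal T}: \text{for some } s\ge1,\ k_s\ge2 \text{ and } k_i=1 \text{ for all } i>s\}$ (so the constant sequence $(1,1,1,\dots)$ is not in $\widehat{\mathcal T}^R$). The order $\succ$ on $\widehat{\mathcal T}$ is: $\mathbf k\succ\mathbf l$ if and only if there is $r_0\ge1$ with $k_i=l_i$ for $i<r_0$ and $k_{r_0}<l_{r_0}$ (the lexicographic order induced by the reversed order on $\mathbb N$). That the limit defining $\eta_n$ exists and lies in $(1,+\infty)$ is part of the assertion. *)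

(* Defs.v *)
From HB Require Import structures.
From mathcomp Require Import all_boot all_order all_algebra.
From mathcomp Require Import all_classical all_reals all_analysis.

Set Implicit Arguments.
Unset Strict Implicit.
Unset Printing Implicit Defensive.

Import Order.TTheory GRing.Theory Num.Theory.
Import numFieldNormedType.Exports.

Local Open Scope classical_set_scope.
Local Open Scope ring_scope.

(** Lebesgue measure on R^d, as the d-fold product of the Lebesgue measure of R
    (for d = 0: the unit mass on the one-point space). *)
Fixpoint lebesgue_tuple (R : realType) (d : nat) :
    set (d.-tuple (measurableTypeR R)) -> \bar R :=
  match d with
  | 0%N => \d_ [tuple]
  | d'.+1 =>
      pushforward (@lebesgue_measure R \x @lebesgue_tuple R d')%E
        (fun xy : measurableTypeR R * d'.-tuple (measurableTypeR R) =>
           [tuple of xy.1 :: xy.2])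
  end.

Section lebesgue_tuple_measure.
Context {R : realType}.
Let X := measurableTypeR R.
Let consp d (xy : X * d.-tuple X) : d.+1.-tuple X := [tuple of xy.1 :: xy.2].

Let measurable_consp d : measurable_fun setT (@consp d).
Proof. exact: measurable_cons. Qed.

Let lebesgue_tuple_bundled d :
  exists mu : {sigma_finite_measure set (d.-tuple X) -> \bar R},
    @lebesgue_tuple R d = mu :> (set (d.-tuple X) -> \bar R).
Proof.
elim: d => [|d [mu muE]]; first by exists \d_ [tuple].
pose P : {measure set (d.+1.-tuple X) -> \bar R} :=
  @measure_function_pushforward__canonical__measure_function_Measure _ _ _ _ R
    (@lebesgue_measure R \x mu)%E _ (@measurable_consp d).
have sP : sigma_finite setT P.
  have /sigma_finiteP[F [TF ndF Foo]] := sigma_finiteT (@lebesgue_measure R).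
  have /sigma_finiteP[G [TG ndG Goo]] := sigma_finiteT mu.
  exists (fun i => [set x : d.+1.-tuple X |
      F i (thead x) /\ G i [tuple of behead x]]) => [|i].
    apply/esym/seteqP; split=> // x _.
    have [i _ Fi] : (\bigcup_i F i) (thead x) by rewrite -TF.
    have [j _ Gj] : (\bigcup_j G j) [tuple of behead x] by rewrite -TG.
    exists (maxn i j) => //; split.
    - by move: (thead x) Fi; exact/subsetPset/ndF/leq_maxl.
    - by move: Gj; move: [tuple of _]; exact/subsetPset/ndG/leq_maxr.
  have [mF Fi] := Foo i; have [mG Gi] := Goo i; split.
    apply: measurableI; rewrite -[X in measurable X]setTI.
    - exact: measurable_tnth.
    - exact: measurable_behead.
  rewrite /P /= /pushforward [X in (_ \x _)%E X](_ : _ = F i `*` G i).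
    by rewrite product_measure1E// lte_mul_pinfty// ge0_fin_numE.
  have beheadE x y : [tuple of behead (@consp d (x, y))] = y :> d.-tuple X.
    exact/val_inj.
  by apply/seteqP; split=> -[x y] [Fx Gy]; split => //;
    move: Gy; rewrite /= beheadE.
by exists (HB.pack_for {sigma_finite_measure set (d.+1.-tuple X) -> \bar R}
  (P : set _ -> _) (Measure.class P)
  (Measure_isSigmaFinite.Build _ _ _ P sP)); rewrite /= muE.
Qed.

Variable d : nat.

Let lebesgue_tuple0 : @lebesgue_tuple R d set0 = 0%E.
Proof. by have [mu ->] := lebesgue_tuple_bundled d; rewrite measure0. Qed.

Let lebesgue_tuple_ge0 A : (0 <= @lebesgue_tuple R d A)%E.
Proof. by have [mu ->] := lebesgue_tuple_bundled d; exact: measure_ge0. Qed.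

Let lebesgue_tuple_sigma_additive : semi_sigma_additive (@lebesgue_tuple R d).
Proof.
have [mu ->] := lebesgue_tuple_bundled d; exact: measure_semi_sigma_additive.
Qed.

HB.instance Definition _ := isMeasure.Build _ _ _ (@lebesgue_tuple R d)
  lebesgue_tuple0 lebesgue_tuple_ge0 lebesgue_tuple_sigma_additive.

Let lebesgue_tuple_sigma_finite : sigma_finite setT (@lebesgue_tuple R d).
Proof. by have [mu ->] := lebesgue_tuple_bundled d; exact: sigma_finiteT. Qed.

HB.instance Definition _ := Measure_isSigmaFinite.Build _ _ _
  (@lebesgue_tuple R d) lebesgue_tuple_sigma_finite.

End lebesgue_tuple_measure.

Definition unit_cube (R : realType) (d : nat) :
    set (d.-tuple (measurableTypeR R)) :=
  [set x | forall j : 'I_d, (0 : R) <= tnth x j <= 1].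

(** With 0-based indices, [sumn (take i.+1 ks)] is K_(i+1) = k_1 + ... + k_(i+1),
    so the inner product is x_1 ... x_(K_(i+1)). *)
Definition T_integrand (R : realType) (n : nat) (ks : seq nat)
    (x : (sumn ks).-tuple (measurableTypeR R)) : R :=
  \prod_(i < size ks)
    \sum_(m < n.+1)
      (\prod_(j < sumn ks | (j < sumn (take i.+1 ks))%N) (tnth x j : R)) ^+ m.

Definition T (R : realType) (n : nat) (ks : seq nat) : R :=
  \int[@lebesgue_tuple R (sumn ks)]_(x in @unit_cube R (sumn ks))
    T_integrand n x.

(** A sequence (k_1, k_2, ...) is a function [k : nat -> nat], k_i being
    [k i.-1]. *)
Definition That : set (nat -> nat) := [set k | forall i, (1 <= k i)%N].

Definition That2 : set (nat -> nat) := [set k | forall i, (2 <= k i)%N].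

Definition ThatR : set (nat -> nat) :=
  [set k | That k /\
     exists s, (2 <= k s)%N /\ forall i, (s < i)%N -> k i = 1%N].

Definition seq_succ (k l : nat -> nat) : Prop :=
  exists r0, (forall i, (i < r0)%N -> k i = l i) /\ (k r0 < l r0)%N.

(** The sequence r |-> T_n(k_1, ..., k_r). *)
Definition T_trunc (R : realType) (n : nat) (k : nat -> nat) : R^nat :=
  fun r => T R n (mkseq k r).

Definition eta_lim (R : realType) (n : nat) (k : nat -> nat) : R :=
  limn (T_trunc R n k).

Definition diameter (R : realType) (U : set R) : \bar R :=
  ereal_sup [set `|x.1 - x.2|%:E | x in U `*` U].

(** |U|^s, with the convention that the empty set contributes 0 for every s,
    including s = 0 (where 0 `^ 0 = 1, so that a point contributes 1). *)
Definition hausdorff_gauge (R : realType) (s : R) (U : set R) : \bar R :=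
  if `[< U = set0 >] then 0%E else (diameter U `^ s)%E.

Definition hausdorff_premeasure (R : realType) (s delta : R) (A : set R) :
    \bar R :=
  ereal_inf [set (\sum_(0 <= i <oo) hausdorff_gauge s (U i))%E |
    U in [set U : (set R)^nat |
      (forall i, (diameter (U i) <= delta%:E)%E) /\ A `<=` \bigcup_i U i]].

Definition hausdorff_measure (R : realType) (s : R) (A : set R) : \bar R :=
  ereal_sup [set hausdorff_premeasure s delta A |
    delta in [set delta : R | 0 < delta]].

Definition hausdorff_dim (R : realType) (A : set R) : \bar R :=
  ereal_inf [set s%:E | s in [set s : R | 0 <= s /\
                                hausdorff_measure s A = 0%E]].

(* Main.v *)
(** Expanding the integrand, T_n(k_1, ..., k_r) is the sum of prod_i N_i^-k_i over
    the chains 1 <= N_r <= ... <= N_1 whose steps, starting from 1, are at most n.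
    It is the value at 1 of the polynomial obtained from 1 by applying the operators
    "multiply by 1 + X + ... + X^n, then divide the coefficient of X^i by
    (i+1)^k", for k = k_r, ..., k_1; dually, appending k_r to the sequence acts on a
    nonincreasing weight function on the indices.

    For k = 1 the operator is x p |-> int_0^x p(t) (1 + ... + t^n) dt, with fixed
    point x exp(g), g = x + x^2/2 + ... + x^n/n, and eigenfunction x^2 exp(2g) for
    the eigenvalue 1/2. This gives the value at (1, 1, ...), and the diameter of the
    cylinder of prefix w is of order 2^-(sum of w). Cylinders of consecutive digits
    overlap because exp(g) dominates 1 + ... + x^n coefficientwise, so a greedy
    expansion reaches every value. When all entries are at least 2 the cylinders are
    instead separated by gaps comparable to their size, by comparing partial sums of
    coefficients. For the dimension, the set is covered by Fibonacci many intervals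
    of length C 2^-m, and sending the address k to the expansion
    sum_r phi^-(k_1 + ... + k_r) in the golden base phi = 2^dim is a Hoelder map of
    exponent dim onto an interval. *)

Require Import Defs.
From mathcomp Require Import all_boot all_order all_algebra.
From mathcomp Require Import all_classical all_reals all_analysis.
From mathcomp Require Import measurable_realfun ring lra.

Set Implicit Arguments.
Unset Strict Implicit.
Unset Printing Implicit Defensive.

Import Order.TTheory GRing.Theory Num.Theory.
Import numFieldNormedType.Exports.

Local Open Scope classical_set_scope.
Local Open Scope ring_scope.

(** * The operators and their duals *)

Section Duality.
Context (R : realFieldType) (n : nat).
Implicit Types (p q : {poly R}) (a b : nat -> R) (k : nat) (w u : seq nat).

Definition geo : {poly R} := \poly_(j < n.+1) 1.

(** As [int_0^1 (z t)^i dt = z^i / (i+1)], [ddiv 1] averages a polynomial over [[0, z]], and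
    [ddiv k] integrates out [k] variables. *)
Definition ddiv k p : {poly R} := \poly_(i < size p) (p`_i / i.+1%:R ^+ k).

Definition bstep k p : {poly R} := ddiv k (p * geo).

Definition T_poly ks : {poly R} := foldr bstep 1 ks.

Definition T_value ks : R := (T_poly ks).[1].

Definition wstep k a : nat -> R :=
  fun i => \sum_(j < n.+1) a (i + j)%N / (i + j).+1%:R ^+ k.

(** The linear functional by which the prefix [w] acts on the coefficients of suffix polynomials.
    With [foldl], appending an entry is one [wstep]. *)
Definition T_weight w : nat -> R := foldl (fun a k => wstep k a) (fun=> 1) w.

Definition pairing p a : R := \sum_(i < size p) p`_i * a i.

Lemma coef_geo i : geo`_i = (i <= n)%:R.
Proof. by rewrite coef_poly ltnS; case: leqP. Qed.

Lemma coef_ddiv k p i : (ddiv k p)`_i = p`_i / i.+1%:R ^+ k.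
Proof. by rewrite coef_poly; case: ltnP => // /leq_sizeP ->; rewrite ?mul0r. Qed.

Lemma coef_bstep k p i :
  (bstep k p)`_i = (\sum_(j < i.+1) p`_j * (i - j <= n)%:R) / i.+1%:R ^+ k.
Proof.
rewrite coef_ddiv coefM; congr (_ / _).
by apply: eq_bigr => j _; rewrite coef_geo.
Qed.

Lemma invX_ge0 (i k : nat) : 0 <= (i.+1%:R ^+ k)^-1 :> R.
Proof. by rewrite invr_ge0 exprn_ge0. Qed.

Lemma invX_gt0 (i k : nat) : 0 < (i.+1%:R ^+ k)^-1 :> R.
Proof. by rewrite invr_gt0 exprn_gt0. Qed.

Lemma ddivD k l p : ddiv (k + l) p = ddiv k (ddiv l p).
Proof.
apply/polyP => i; rewrite !coef_ddiv exprD invfM; ring.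
Qed.

Lemma pairing_widen N p a : (size p <= N)%N ->
  pairing p a = \sum_(i < N) p`_i * a i.
Proof.
move=> pN; rewrite /pairing (big_ord_widen _ (fun i => p`_i * a i) pN).
rewrite big_mkcond/=; apply: eq_bigr => i _; case: ltnP => // /leq_sizeP ->//.
by rewrite mul0r.
Qed.

Lemma le_pairing p q a b : (forall i, p`_i * a i <= q`_i * b i) ->
  pairing p a <= pairing q b.
Proof.
move=> pq; rewrite (pairing_widen _ (leq_maxl (size p) (size q))).
rewrite (pairing_widen _ (leq_maxr (size p) (size q))).
by apply: ler_sum => i _.
Qed.

Lemma le_pairingl p q a : (forall i, p`_i <= q`_i) -> (forall i, 0 <= a i) ->
  pairing p a <= pairing q a.
Proof. by move=> pq a0; apply: le_pairing => i; rewrite ler_wpM2r. Qed.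

Lemma pairingD p q a : pairing (p + q) a = pairing p a + pairing q a.
Proof.
set N := maxn (size p) (size q).
rewrite !(@pairing_widen N) ?leq_maxl ?leq_maxr ?size_polyD//.
by rewrite -big_split; apply: eq_bigr => i _; rewrite coefD mulrDl.
Qed.

Lemma pairingZ c p a : pairing (c *: p) a = c * pairing p a.
Proof.
rewrite !(@pairing_widen (size p)) ?size_scale_leq//.
by rewrite mulr_sumr; apply: eq_bigr => i _; rewrite coefZ mulrA.
Qed.

Lemma pairingB p q a : pairing (p - q) a = pairing p a - pairing q a.
Proof. by rewrite pairingD -scaleN1r pairingZ mulN1r. Qed.

Lemma pairing_sum (I : finType) (F : I -> {poly R}) a :
  pairing (\sum_i F i) a = \sum_i pairing (F i) a.
Proof.
elim/big_rec2: _ => [|i x y _ <-]; last by rewrite pairingD.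
by rewrite /pairing size_poly0 big_ord0.
Qed.

Lemma pairing_mulXn p m a : pairing (p * 'X^m) a = pairing p (fun i => a (i + m)%N).
Proof.
rewrite (@pairing_widen (m + size p)); last first.
  by rewrite (leq_trans (size_polyMleq _ _))// size_polyXn addnS/= addnC.
rewrite big_split_ord/= big1 ?add0r => [|i _]; last first.
  by rewrite coefMXn ltn_ord mul0r.
by apply: eq_bigr => i _; rewrite coefMXn ltnNge leq_addr/= addKn addnC.
Qed.

Lemma pairing_ddiv k p a :
  pairing (ddiv k p) a = pairing p (fun i => a i / i.+1%:R ^+ k).
Proof.
rewrite (@pairing_widen (size p)) ?size_poly//.
by apply: eq_bigr => i _; rewrite coef_ddiv mulrAC mulrA.
Qed.

Lemma geoE : geo = \sum_(j < n.+1) 'X^j.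
Proof. by rewrite /geo poly_def; apply: eq_bigr => i _; rewrite scale1r. Qed.

Lemma pairing_geo p a :
  pairing (p * geo) a = pairing p (fun i => \sum_(j < n.+1) a (i + j)%N).
Proof.
rewrite geoE mulr_sumr pairing_sum.
under eq_bigr do rewrite pairing_mulXn /pairing.
by rewrite exchange_big/=; apply: eq_bigr => i _; rewrite mulr_sumr.
Qed.

Lemma pairing_bstep k p a : pairing (bstep k p) a = pairing p (wstep k a).
Proof. by rewrite pairing_ddiv pairing_geo. Qed.

Lemma pairing1 a : pairing 1 a = a 0%N.
Proof. by rewrite /pairing size_poly1 big_ord1 coef1 mul1r. Qed.

Lemma pairing_horner p : pairing p (fun=> 1) = p.[1].
Proof. by rewrite horner_coef; apply: eq_bigr => i _; rewrite expr1n. Qed.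

Lemma pairingX a : pairing 'X a = a 1%N.
Proof. by rewrite -['X]mul1r -['X]expr1 pairing_mulXn pairing1. Qed.

Lemma pairing_cst p c : pairing p (fun=> c) = c * p.[1].
Proof.
by rewrite -pairing_horner /pairing mulr_sumr; apply: eq_bigr => i _; ring.
Qed.

Lemma pairing_foldr p w a :
  pairing (foldr bstep p w) a = pairing p (foldl (fun a k => wstep k a) a w).
Proof. by elim: w a => //= k w IH a; rewrite pairing_bstep IH. Qed.

(** Separates prefix from suffix: comparing extensions of [w] reduces to comparing suffix
    polynomials under one fixed functional. *)
Lemma Tval_cat w u : T_value (w ++ u) = pairing (T_poly u) (T_weight w).
Proof.
by rewrite /T_value -pairing_horner /T_poly foldr_cat pairing_foldr.
Qed.

Lemma TvalE w : T_value w = T_weight w 0%N.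
Proof. by rewrite -{1}[w]cats0 Tval_cat pairing1. Qed.

Lemma weight_rcons w k : T_weight (rcons w k) = wstep k (T_weight w).
Proof. by rewrite /T_weight foldl_rcons. Qed.

Lemma Tval_rcons_cat w k u :
  T_value (w ++ k :: u) = pairing (T_poly u) (wstep k (T_weight w)).
Proof. by rewrite -cat_rcons Tval_cat weight_rcons. Qed.

Lemma wstep_ge0 k a : (forall i, 0 <= a i) -> forall i, 0 <= wstep k a i.
Proof. by move=> a0 i; apply: sumr_ge0 => j _; rewrite mulr_ge0 ?invX_ge0. Qed.

Lemma weight_ge0 w i : 0 <= T_weight w i.
Proof.
elim/last_ind: w i => [|w k IH] i; first by rewrite /T_weight/= ler01.
by rewrite weight_rcons wstep_ge0.
Qed.

Lemma weight_nonincr w i j : (i <= j)%N -> T_weight w j <= T_weight w i.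
Proof.
elim/last_ind: w i j => [//|w k IH] i j ij; rewrite weight_rcons.
apply: ler_sum => m _; apply: ler_pM; rewrite ?weight_ge0 ?invX_ge0//.
- by rewrite IH// leq_add2r.
- by rewrite lef_pV2 ?posrE ?exprn_gt0// lerXn2r ?nnegrE// ler_nat ltnS leq_add2r.
Qed.

Lemma tpoly_ge0 u i : 0 <= (T_poly u)`_i.
Proof.
elim: u i => [|k u IH] i /=; first by rewrite coef1; case: eqP.
rewrite coef_bstep mulr_ge0 ?invX_ge0// sumr_ge0// => j _.
by rewrite mulr_ge0.
Qed.

Lemma tpoly_coef0 u : (T_poly u)`_0 = 1.
Proof.
elim: u => [|k u IH] /=; first by rewrite coef1.
by rewrite coef_bstep big_ord1 IH mulr1 expr1n divr1.
Qed.

Lemma wstep_ge k a i : (forall i, 0 <= a i) -> a i / i.+1%:R ^+ k <= wstep k a i.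
Proof.
move=> a0; rewrite /wstep big_ord_recl/= addn0 lerDl.
by apply: sumr_ge0 => j _; rewrite mulr_ge0 ?invX_ge0.
Qed.

(** Keeping only the term [j = 0] of every [wstep] at index 1 leaves one factor [2^-k] per entry. *)
Lemma weight1_ge w : 2%:R ^- sumn w <= T_weight w 1%N.
Proof.
elim/last_ind: w => [|w k IH]; first by rewrite /T_weight/= expr0 invr1.
rewrite weight_rcons sumn_rcons exprD invfM.
apply: le_trans (wstep_ge k 1 (weight_ge0 w)).
by rewrite ler_wpM2r ?invX_ge0.
Qed.

Lemma weight_gt0 w i : 0 < T_weight w i.
Proof.
elim/last_ind: w i => [|w k IH] i; first by rewrite /T_weight/= ltr01.
rewrite weight_rcons; apply: lt_le_trans (wstep_ge k i (weight_ge0 w)).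
by rewrite mulr_gt0 ?invX_gt0.
Qed.

Lemma Tval_ge w u : T_value w <= T_value (w ++ u).
Proof.
elim/last_ind: u => [|u k IH]; first by rewrite cats0.
rewrite (le_trans IH)// -rcons_cat !TvalE weight_rcons.
by apply: le_trans (wstep_ge k 0 (weight_ge0 _)); rewrite expr1n divr1.
Qed.

Lemma Tval_rcons_sub w k :
  T_value (rcons w k) - T_value w = \sum_(j < n) T_weight w j.+1 / j.+2%:R ^+ k.
Proof.
rewrite !TvalE weight_rcons /wstep big_ord_recl/= add0n expr1n divr1 addrC addKr.
by apply: eq_bigr => i _; rewrite add0n.
Qed.

End Duality.

(** * Exponential bounds *)

Lemma deriv_mulX_ddiv (R : realFieldType) (p : {poly R}) : ('X * ddiv 1 p)^`() = p.
Proof.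
apply/polyP => i; rewrite coef_deriv coefXM/= coef_ddiv expr1.
by rewrite -[LHS]mulr_natr mulfVK// pnatr_eq0.
Qed.

Section ExponentialBounds.
Context (R : realType) (n : nat).

(* [x exp(logphi x)] is the fixed point of [bstep 1], up to the shift by [x]. *)
Definition logphi : {poly R} := 'X * ddiv 1 (\poly_(j < n) 1).

Lemma logphiE x : logphi.[x] = \sum_(1 <= j < n.+1) x ^+ j / j%:R.
Proof.
rewrite /logphi mulrC hornerMX.
rewrite (@horner_coef_wide _ n) ?(leq_trans (size_poly _ _)) ?size_poly//.
rewrite mulr_suml big_add1/= big_mkord; apply: eq_bigr => i _.
by rewrite coef_ddiv coef_poly ltn_ord mul1r expr1 exprSr; ring.
Qed.

(** With [g = logphi], the factor [1 + x g'] is the one in the derivative of [x exp(g)], which is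
    therefore [geo * exp(g)]. *)
Lemma deriv_logphi : 1 + 'X * logphi^`() = geo R n.
Proof.
rewrite deriv_mulX_ddiv; apply/polyP => i.
rewrite coefD coef1 coefXM !coef_poly; case: i => [|i] /=; first by rewrite addr0.
by rewrite add0r ltnS.
Qed.

Lemma logphi_ge0 x : 0 <= x -> 0 <= logphi.[x].
Proof.
by move=> x0; rewrite logphiE sumr_ge0// => j _; rewrite mulr_ge0 ?exprn_ge0.
Qed.

Lemma logphi_le x : 0 <= x <= 1 -> logphi.[x] <= n%:R * x.
Proof.
move=> /andP[x0 x1]; rewrite logphiE big_add1/= big_mkord.
apply: (@le_trans _ _ (\sum_(i < n) x)); last by rewrite sumr_const card_ord mulr_natl.
apply: ler_sum => i _; rewrite -[leRHS]mulr1; apply: ler_pM => //.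
- exact: exprn_ge0.
- by rewrite exprS ler_piMr// exprn_ile1.
- by rewrite invf_le1 ?ler1n ?ltr0n.
Qed.

(** Comparison principle: [x * bstep 1 p] is the antiderivative of [p * geo] vanishing at 0, so a
    bound on [p] integrates to a bound on [bstep 1 p]. *)
Lemma bstep1_le (p : {poly R}) (G H : R -> R) :
  (forall x, 0 < x <= 1 -> p.[x] <= G x) ->
  (forall x : R, is_derive x 1 (fun x => x * H x) ((geo R n).[x] * G x)) ->
  forall x, 0 < x <= 1 -> (bstep n 1 p).[x] <= H x.
Proof.
move=> pG dH x /andP[x0 x1].
pose f := (fun x => x * H x) - horner ('X * bstep n 1 p).
pose df x : R := (geo R n).[x] * G x - (p * geo R n).[x].
have dfE (y : R) : is_derive y 1 f (df y).
  have := is_derive_poly ('X * bstep n 1 p) y.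
  rewrite deriv_mulX_ddiv => dp.
  exact: is_deriveB.
have [|c] := MVT x0 (fun y _ => dfE y).
  apply: derivable_within_continuous => y _.
  by have := dfE y => -[].
rewrite in_itv/= => /andP[c0 cx].
have f0 : f 0 = 0.
  by rewrite /f !fctE hornerM hornerX !mul0r subrr.
have fx : f x = x * (H x - (bstep n 1 p).[x]).
  by rewrite /f !fctE hornerM hornerX mulrBr.
rewrite f0 fx !subr0 => E.
rewrite -subr_ge0 -(pmulr_rge0 _ x0) E mulr_ge0 ?(ltW x0)//.
rewrite /df hornerM mulrC -mulrBl mulr_ge0 ?subr_ge0 ?pG ?c0 ?(le_trans (ltW cx))//.
rewrite geoE horner_sum sumr_ge0// => i _.
by rewrite hornerXn exprn_ge0 ?ltW.
Qed.

Lemma is_derive_logphi (x : R) :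
  is_derive x 1 (fun x => expR logphi.[x]) (expR logphi.[x] * logphi^`().[x]).
Proof.
have d := @is_derive1_comp R expR (horner logphi) x _ _ _ (is_derive_poly logphi x).
exact: d.
Qed.

Lemma is_derive_phi (x : R) :
  is_derive x 1 (fun x => x * expR logphi.[x]) ((geo R n).[x] * expR logphi.[x]).
Proof.
have h := is_derive_logphi x.
have d := is_deriveM (is_derive_id x 1) h.
have -> : (fun x => x * expR logphi.[x]) = id * (fun x => expR logphi.[x]).
  by apply/funext => y; rewrite fctE.
apply: (is_derive_eq d).
rewrite -deriv_logphi hornerD (hornerM _ logphi^`()) hornerX hornerC.
rewrite !scaler1 /GRing.scale/=.
ring.
Qed.

(* [x^2 exp(2 logphi x)] is the eigenfunction of [bstep 1] for the eigenvalue
   [1/2], up to the shift by [x]. *)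
Lemma is_derive_phi2 (c x : R) :
  is_derive x 1 (fun x => x * (c * (x * expR (logphi.[x]) ^+ 2)))
    ((geo R n).[x] * (2 * c * (x * expR logphi.[x] ^+ 2))).
Proof.
have h := is_derive_phi x.
have d := is_deriveZ c (is_deriveX 2 h).
have -> : (fun x => x * (c * (x * expR (logphi.[x]) ^+ 2))) =
   (c *: (fun x => x * expR logphi.[x]) ^+ 2).
  by apply/funext => y; rewrite !fctE /GRing.scale/=; ring.
apply: (is_derive_eq d).
rewrite /= /GRing.scale/= !expr1; ring.
Qed.

Definition ones r : {poly R} := iter r (bstep n 1) 1.

Lemma tpoly_nseq r k : T_poly R n (nseq r k) = iter r (bstep n k) 1.
Proof. by elim: r => //= r ->. Qed.

Lemma ones_le r x : 0 < x <= 1 -> (ones r).[x] <= expR logphi.[x].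
Proof.
elim: r x => [|r IH] x x01.
  rewrite /ones/= hornerC -[leLHS]expR0 ler_expR logphi_ge0//.
  by case/andP: x01 => /ltW.
exact: (bstep1_le IH is_derive_phi x01).
Qed.

(** [X] is dominated by the eigenfunction, and each step preserves the bound up to the eigenvalue
    [1/2]. *)
Lemma iter_bstepX_le r x : 0 < x <= 1 ->
  (iter r (bstep n 1) 'X).[x] <= 2 ^- r * (x * expR logphi.[x] ^+ 2).
Proof.
elim: r x => [|r IH] x x01.
  rewrite /= hornerX expr0 invr1 mul1r; case/andP: x01 => x0 _.
  by rewrite ler_peMr ?(ltW x0)// exprn_ege1// -expR0 ler_expR logphi_ge0 ?ltW.
rewrite iterS.
pose H y : R := 2 ^- r.+1 * (y * expR logphi.[y] ^+ 2).
apply: (@bstep1_le _ _ H IH _ x x01).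
move=> y; apply: is_derive_eq (is_derive_phi2 _ y) _.
rewrite exprS invfM; field; exact: expf_neq0.
Qed.

(** The distance to the fixed point is dominated by [n] times the eigenfunction at [r = 0], hence
    halves at every step. Negating [ones r] turns this into an upper bound, to which [bstep1_le]
    applies. *)
Lemma ones_ge r x : 0 < x <= 1 ->
  expR logphi.[x] - n%:R * 2 ^- r * (x * expR logphi.[x] ^+ 2) <= (ones r).[x].
Proof.
move=> x01; rewrite -lerN2.
have -> : - (ones r).[x] = (- ones r).[x] by rewrite hornerN.
elim: r x x01 => [|r IH] x x01; last first.
  have -> : - ones r.+1 = bstep n 1 (- ones r).
    apply/polyP => i; rewrite coefN !coef_bstep -mulNr; congr (_ / _).
    by rewrite -sumrN; apply: eq_bigr => j _; rewrite coefN mulNr.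
  pose H y : R := - (expR logphi.[y] - n%:R * 2 ^- r.+1 * (y * expR logphi.[y] ^+ 2)).
  apply: (@bstep1_le _ _ H IH _ x x01).
  move=> y; have h1 := is_derive_phi y.
  have h2 := is_derive_phi2 (n%:R * 2 ^- r.+1) y.
  have d := is_deriveB h2 h1.
  have -> : (fun x => x * - (expR logphi.[x] -
       n%:R / 2 ^+ r.+1 * (x * expR logphi.[x] ^+ 2))) =
    (fun x => x * (n%:R / 2 ^+ r.+1 * (x * expR logphi.[x] ^+ 2))) -
    (fun x => x * expR logphi.[x]).
    by apply/funext => z; rewrite !fctE; ring.
  apply: (is_derive_eq d).
  rewrite exprS invfM; field; exact: expf_neq0.
(* Base case: with [E = exp(logphi x)], the inequality [1 - logphi x <= 1 / E] gives
   [E - 1 <= logphi x * E <= n x E^2]. *)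
rewrite /ones/= hornerN hornerC lerN2 expr0 invr1 mulr1.
case/andP: x01 => x0 x1.
set E := expR logphi.[x].
have E1 : 1 <= E by rewrite /E -expR0 ler_expR logphi_ge0 ?ltW.
have gE : (1 - logphi.[x]) * E <= 1.
  have := expR_ge1Dx (- logphi.[x]); rewrite expRN -/E => h.
  by rewrite -ler_pdivlMr ?expR_gt0// div1r.
have h1 := @logphi_le x; rewrite (ltW x0) x1 in h1; have {}h1 := h1 isT.
have : logphi.[x] * E <= n%:R * x * E ^+ 2.
  apply: ler_pM => //; rewrite ?logphi_ge0 ?expR_ge0 ?(ltW x0)//.
  by rewrite expr2 ler_peMr// expR_ge0.
by move: gE; lra.
Qed.

End ExponentialBounds.

(** * Evaluation of the integrals *)

Section CubeIntegral.
Context {R : realType}.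
Local Notation X := (measurableTypeR R).

Lemma measurable_unit_cube d : measurable (@unit_cube R d).
Proof.
have -> : @unit_cube R d =
    \bigcap_(j in [set: 'I_d]) ((fun x : d.-tuple X => tnth x j) @^-1` `[0, 1]).
  apply/seteqP; split => x /=; first by move=> h j _ /=; rewrite in_itv; exact: h.
  by move=> h j; have := h j Logic.I; rewrite /= in_itv.
apply: fin_bigcap_measurable; first exact: finite_finset.
move=> j _; rewrite -[X in measurable X]setTI.
exact: (@measurable_tnth _ X d j measurableT _ (measurable_itv _)).
Qed.

Lemma unit_cube_cons d (x : X) (y : d.-tuple X) :
  unit_cube [tuple of x :: y] <-> (`[0, 1]%classic : set R) x /\ unit_cube y.
Proof.
split=> [h|[/= x01 h] j].
  split=> [|j]; first by have := h ord0; rewrite tnth0 /= in_itv.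
  by have := h (lift ord0 j); rewrite tnthS.
case: (unliftP ord0 j) => [i ->|->]; first by rewrite tnthS; exact: h.
by move: x01; rewrite tnth0 in_itv.
Qed.

Lemma integral_unit_cubeS d (f : d.+1.-tuple X -> R) :
  measurable_fun setT f -> (forall x, unit_cube x -> 0 <= f x) ->
  (\int[@lebesgue_tuple R d.+1]_(x in @unit_cube R d.+1) (f x)%:E =
   \int[@lebesgue_measure R]_(x in `[0%R, 1%R])
     \int[@lebesgue_tuple R d]_(y in @unit_cube R d) (f [tuple of x :: y])%:E)%E.
Proof.
move=> mf f0.
(* Extending [f] by 0 outside the cube lets Tonelli be applied on the whole product space. *)
pose g : d.+1.-tuple X -> \bar R := (EFin \o f) \_ (@unit_cube R d.+1).
have g0 x : (0 <= g x)%E.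
  rewrite /g patchE; case: ifPn => //; rewrite inE => hx.
  by rewrite lee_fin f0.
have mg : measurable_fun [set: d.+1.-tuple X] g.
  have h := (measurable_restrictT (EFin \o f) (@measurable_unit_cube d.+1)).
  by apply: h.1; apply/measurable_EFinP/measurable_funTS.
pose consp (xy : X * d.-tuple X) : d.+1.-tuple X := [tuple of xy.1 :: xy.2].
have mcons : measurable_fun setT consp by exact: measurable_cons.
rewrite integral_mkcond.
transitivity (\int[(@lebesgue_measure R \x @lebesgue_tuple R d)]_xy (g (consp xy)))%E.
  pose mu : {measure set (X * d.-tuple X) -> \bar R} :=
    (@lebesgue_measure R \x @lebesgue_tuple R d)%E.
  have pushE := ge0_integral_pushforward mcons mu measurableT mg (fun y _ => g0 y).
  by rewrite preimage_setT in pushE; rewrite -pushE.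
rewrite (@fubini_tonelli1 _ _ _ _ _ _ _ (g \o consp)); last 2 first.
- exact: measurableT_comp.
- by move=> x; exact: g0.
rewrite [RHS]integral_mkcond; apply: eq_integral => x _.
rewrite /fubini_F patchE; case: ifPn => [|/negP x01]; last first.
  apply: integral0_eq => y _; rewrite /= /g patchE; case: ifPn => //.
  by rewrite inE /= => /unit_cube_cons[h _]; exfalso; apply: x01; rewrite inE.
rewrite inE => x01; rewrite [RHS]integral_mkcond; apply: eq_integral => y _ /=.
rewrite /g !patchE; case: ifPn => [|/negP y01].
  by rewrite inE => /unit_cube_cons[_ h]; rewrite mem_set.
case: ifPn => //; rewrite inE => h; exfalso; apply: y01; rewrite inE.
exact/unit_cube_cons.
Qed.

Lemma integral_unit_cube0 (c : R) :
  (\int[@lebesgue_tuple R 0]_(x in @unit_cube R 0) c%:E = c%:E)%E.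
Proof.
rewrite integral_cst; last exact: measurable_unit_cube.
have -> : @unit_cube R 0 = setT by apply/seteqP; split=> // x _ [].
by rewrite -[RHS]mule1; congr (_ * _)%E; rewrite /lebesgue_tuple/= diracT.
Qed.

Lemma integral_horner_ddiv (p : {poly R}) :
  (\int[@lebesgue_measure R]_(x in `[0%R, 1%R]) (p.[x])%:E = (ddiv 1 p).[1]%:E)%E.
Proof.
rewrite (@continuous_FTC2 R (horner p) (horner ('X * ddiv 1 p)))//.
- by rewrite !hornerM !hornerX mul1r mul0r sube0.
- by apply: continuous_subspaceT; exact: continuous_horner.
- split => [x _||].
  + exact: derivable_horner.
  + exact/cvg_at_right_filter/continuous_horner.
  + exact/cvg_at_left_filter/continuous_horner.
- by move=> x _; rewrite -derivE deriv_mulX_ddiv.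
Qed.

Lemma integral_horner_dilate (p : {poly R}) (z : R) :
  (\int[@lebesgue_measure R]_(x in `[0%R, 1%R]) (p.[z * x])%:E = (ddiv 1 p).[z]%:E)%E.
Proof.
pose q : {poly R} := \poly_(i < size p) (p`_i * z ^+ i).
transitivity (\int[@lebesgue_measure R]_(x in `[0%R, 1%R]) (q.[x])%:E)%E.
  apply: eq_integral => x _; congr (_%:E); rewrite horner_coef horner_poly.
  by apply: eq_bigr => i _; rewrite exprMn mulrA.
rewrite integral_horner_ddiv; congr (_%:E).
rewrite (@horner_coef_wide _ (size p)); last first.
  by rewrite (leq_trans (size_poly _ _))// size_poly.
rewrite /ddiv horner_poly; apply: eq_bigr => i _.
by rewrite -/(ddiv 1 q) coef_ddiv coef_poly ltn_ord expr1n mulr1 mulrAC.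
Qed.

Context (n : nat).

(** The integrand after some variables are fixed: [z] is the product of those variables, and each
    [c] counts the remaining variables that enter its factor. *)
Definition cutprod d (cs : seq nat) (z : R) (x : d.-tuple X) : R :=
  \prod_(c <- cs) (geo R n).[z * \prod_(j < d | (j < c)%N) tnth x j].

Lemma measurable_cutprod d cs z : measurable_fun setT (@cutprod d cs z).
Proof.
apply: measurable_prod => c _.
apply: (measurableT_comp (continuous_measurable_fun (@continuous_horner R (geo R n)))).
apply: measurable_funM; first exact: measurable_cst.
under eq_fun do rewrite big_mkcond.
apply: measurable_prod => j _; case: (j < c)%N; last exact: measurable_cst.
exact: measurable_tnth.
Qed.

Lemma geo_ge0 (x : R) : 0 <= x -> 0 <= (geo R n).[x].
Proof.
move=> x0; rewrite geoE horner_sum sumr_ge0// => i _.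
by rewrite hornerXn exprn_ge0.
Qed.

Lemma cutprod_ge0 d cs z x : 0 <= z -> @unit_cube R d x -> 0 <= cutprod cs z x.
Proof.
move=> z0 x01; apply: prodr_ge0 => c _; apply: geo_ge0.
by rewrite mulr_ge0// prodr_ge0// => j _; have /andP[] := x01 j.
Qed.

Lemma cutprod_cons d cs z (x : X) (y : d.-tuple X) :
  cutprod (map S cs) z [tuple of x :: y] = cutprod cs (z * x) y.
Proof.
rewrite /cutprod big_map; apply: eq_bigr => c _; congr (_.[_]).
rewrite big_mkcond big_ord_recl/= tnth0 mulrA; congr (_ * _).
by rewrite -big_mkcond/=; apply: eq_big => j //= _; rewrite tnthS.
Qed.

Lemma cutprod0 d cs z (x : d.-tuple X) :
  cutprod (0%N :: cs) z x = (geo R n).[z] * cutprod cs z x.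
Proof.
rewrite /cutprod big_cons [X in z * X]big_pred0 ?mulr1//.
Qed.

Fixpoint cuts (ks : seq nat) : seq nat :=
  if ks is k :: ks' then k :: map (addn k) (cuts ks') else [::].

(* Integrating out one variable at a time amounts to applying [ddiv 1]. *)
Lemma integral_cutprod ks k z : 0 <= z ->
  (\int[@lebesgue_tuple R (k + sumn ks)]_(x in @unit_cube R (k + sumn ks))
     (cutprod (k :: map (addn k) (cuts ks)) z x)%:E =
   ((ddiv k (T_poly R n ks * geo R n)).[z])%:E)%E.
Proof.
(* Outer induction on the entries, inner on [k]. For [k = 0] the first factor is the constant [geo]
   at [z] and comes out of the integral; otherwise one variable is integrated out. *)
elim: ks k z => [|l ks IHks] k; elim: k => [|k IHk] z z0.
- under eq_integral => x _.
    rewrite cutprod0 /cutprod big_nil; over.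
  rewrite integral_unit_cube0 mulr1 /= mul1r; congr (EFin (horner _ _)).
  by apply/polyP => i; rewrite coef_ddiv divr1.
- rewrite (integral_unit_cubeS (measurable_cutprod _ _)); last first.
    by move=> x; exact: cutprod_ge0.
  under eq_integral => x /[!inE]/= /[!in_itv]/= /andP[x0 x1].
    under eq_integral => y _ do rewrite (cutprod_cons [:: k]).
    rewrite IHk ?mulr_ge0//; over.
  by rewrite integral_horner_dilate -ddivD.
- have m0 : map (addn 0) (cuts (l :: ks)) = cuts (l :: ks).
    by rewrite (eq_map (fun i => add0n i)) map_id.
  rewrite m0.
  under eq_integral => x _.
    rewrite cutprod0 EFinM; over.
  rewrite ge0_integralZl//; first last.
  + by rewrite lee_fin geo_ge0.
  + by move=> x h; rewrite lee_fin; apply: cutprod_ge0.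
  + apply/measurable_EFinP; apply: measurable_funTS; exact: measurable_cutprod.
  + exact: measurable_unit_cube.
  have := IHks l z z0; rewrite /cutprod /= => ->.
  rewrite -EFinM -hornerM mulrC; congr (EFin (horner _ _)).
  by apply/polyP => i; rewrite coef_ddiv divr1.
- rewrite (integral_unit_cubeS (measurable_cutprod _ _)); last first.
    by move=> x; exact: cutprod_ge0.
  have mS : map (addn k.+1) (cuts (l :: ks)) = map S (map (addn k) (cuts (l :: ks))).
    by rewrite -map_comp; apply: eq_map => i; rewrite /= addSn.
  rewrite mS.
  under eq_integral => x /[!inE]/= /[!in_itv]/= /andP[x0 x1].
    under eq_integral => y _ do rewrite (cutprod_cons (k :: map (addn k) (cuts (l :: ks)))).
    rewrite IHk ?mulr_ge0//; over.
  by rewrite integral_horner_dilate -ddivD.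
Qed.

Lemma cutsE ks : cuts ks = [seq sumn (take i.+1 ks) | i <- iota 0 (size ks)].
Proof.
elim: ks => //= k ks IH; rewrite take0 addn0; congr cons.
rewrite IH -map_comp (iotaDl 1) -map_comp; apply: eq_map => i /=.
by rewrite add1n.
Qed.

Lemma T_Tval ks : T R n ks = T_value R n ks.
Proof.
have TE (x : (sumn ks).-tuple X) : T_integrand n x = cutprod (cuts ks) 1 x.
  rewrite /T_integrand /cutprod cutsE big_map -[size ks in RHS]subn0 -/(index_iota 0 (size ks)).
  rewrite big_mkord; apply: eq_bigr => i _.
  rewrite mul1r geoE horner_sum; apply: eq_bigr => m _.
  by rewrite hornerXn.
rewrite /T /Rintegral; under eq_integral do rewrite TE.
case: ks {TE} => [|k ks] /=.
  under eq_integral do rewrite /cutprod /= big_nil.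
  by rewrite integral_unit_cube0 /= /T_value /= hornerC.
by rewrite integral_cutprod ?ler01//.
Qed.

End CubeIntegral.

(** * The limit values *)

Lemma mkseqSr (f : nat -> nat) r : mkseq f r.+1 = rcons (mkseq f r) (f r).
Proof. by rewrite /mkseq -addn1 iotaD map_cat cats1. Qed.

Lemma mkseqD (f : nat -> nat) r s :
  mkseq f (r + s) = mkseq f r ++ mkseq (fun i => f (r + i)%N) s.
Proof.
rewrite /mkseq iotaD map_cat; congr (_ ++ _).
by rewrite -{1}[(0 + r)%N]addn0 iotaDl add0n -map_comp.
Qed.

Lemma all_mkseq (P : pred nat) (f : nat -> nat) r :
  (forall i, P (f i)) -> all P (mkseq f r).
Proof. by move=> Pf; apply/allP => x /mapP[i _ ->]. Qed.

(** Dependent choice for sequences built entry by entry; it serves the greedy expansion of a value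
    and the one in the golden base. *)
Lemma nested_choice (P : seq nat -> nat -> Prop) (I : seq nat -> Prop) :
  I [::] -> (forall w, I w -> exists k, P w k /\ I (rcons w k)) ->
  exists f : nat -> nat, forall r, I (mkseq f r) /\ P (mkseq f r) (f r).
Proof.
move=> I0 IS.
have [g gP] : {g : seq nat -> nat & forall w, I w -> P w (g w) /\ I (rcons w (g w))}.
  apply: (@boolp.choice _ _ (fun w k => I w -> P w k /\ I (rcons w k))) => w.
  have [/IS [k kP]|nI] := pselect (I w); first by exists k.
  by exists 0%N => /nI.
pose W r := iter r (fun w => rcons w (g w)) [::].
have WE r : mkseq (fun r => g (W r)) r = W r.
  by elim: r => // r IH; rewrite mkseqSr IH.
exists (fun r => g (W r)) => r; rewrite WE.
suff IW : I (W r) by split => //; exact: (gP _ IW).1.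
by elim: r => //= r /gP[].
Qed.

(** Letting [r] tend to infinity discards the error term. *)
Lemma le_geometric (R : realType) (A b c z : R) : 0 <= z < 1 ->
  (forall r : nat, A - c * z ^+ r <= b) -> A <= b.
Proof.
move=> /andP[z0 z1] h.
have z2 : `|z| < 1 by rewrite ger0_norm.
have cv : (A - c * z ^+ r) @[r --> \oo] --> A - c * 0.
  by apply: cvgB; [exact: cvg_cst|apply: cvgMr; exact: cvg_expr].
rewrite mulr0 subr0 in cv.
rewrite -(cvg_lim _ cv)//; apply: limr_le; first by apply/cvg_ex; exists A.
by near=> r; exact: h.
Unshelve. all: by end_near. Qed.

Section Eta.
Context (R : realType) (n : nat).
Local Notation Tval := (T_value R n).
Local Notation tpoly := (T_poly R n).
Local Notation weight := (T_weight R n).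
Local Notation eta := (eta_lim R n).

Definition supeta : R := expR (logphi R n).[1].

Lemma supetaE : supeta = expR (\sum_(1 <= j < n.+1) j%:R^-1).
Proof.
by rewrite /supeta logphiE; congr expR; apply: eq_bigr => j _; rewrite expr1n div1r.
Qed.

Lemma supeta_gt0 : 0 < supeta. Proof. exact: expR_gt0. Qed.

(** Along a chain staying at indices [m] with [c <= m+1], every ratio [c / (m+1)] is at most 1, so
    its power [k >= 1] is at most the ratio itself. [c = 1] compares values, [c = 2] compares
    weights at index 1. *)
Lemma weight_le_ones c w i : all (leq 1) w -> (1 <= c)%N -> (c <= i.+1)%N ->
  c%:R ^+ sumn w * weight w i <= c%:R ^+ size w * weight (nseq (size w) 1%N) i.
Proof.
move=> + c1; elim/last_ind: w i => [|w k IH] i //.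
rewrite all_rcons => /andP[k1 w1] ci.
rewrite size_rcons sumn_rcons -[nseq _.+1 _]/(1%N :: nseq _ _).
rewrite (_ : 1%N :: _ = rcons (nseq (size w) 1%N) 1%N); last first.
  by rewrite -cats1 -[[:: 1%N]]/(nseq 1 1%N) -nseqD addn1.
rewrite !weight_rcons /wstep !mulr_sumr; apply: ler_sum => j _.
set m := (i + j)%N.
have cm : (c <= m.+1)%N by rewrite (leq_trans ci)// ltnS leq_addr.
have IHm := IH m w1 cm.
have m0 : 0 < m.+1%:R :> R by [].
have h : c%:R ^+ k / m.+1%:R ^+ k <= c%:R / m.+1%:R :> R.
  have c0 : 0 <= c%:R / m.+1%:R :> R by rewrite divr_ge0.
  have c1' : c%:R / m.+1%:R <= 1 :> R by rewrite ler_pdivrMr// mul1r ler_nat.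
  by rewrite -expr_div_n -[leRHS]expr1; exact: ler_wiXn2l.
rewrite exprD exprSr expr1.
have -> : c%:R ^+ sumn w * c%:R ^+ k * (weight w m / m.+1%:R ^+ k) =
  (c%:R ^+ sumn w * weight w m) * (c%:R ^+ k / m.+1%:R ^+ k) by ring.
have -> : c%:R ^+ size w * c%:R * (weight (nseq (size w) 1%N) m / m.+1%:R) =
  (c%:R ^+ size w * weight (nseq (size w) 1%N) m) * (c%:R / m.+1%:R) by ring.
apply: ler_pM => //; first by rewrite mulr_ge0 ?exprn_ge0// weight_ge0.
Qed.

(** Upper counterpart of [weight1_ge]. After the comparison with ones, duality turns the weight at 1
    into the value at 1 of [bstep 1] iterated on [X]. *)
Lemma weight1_le w : all (leq 1) w -> weight w 1 <= supeta ^+ 2 / 2 ^+ sumn w.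
Proof.
move=> w1; rewrite ler_pdivlMr ?exprn_gt0// mulrC.
apply: le_trans (weight_le_ones w1 (isT : (1 <= 2)%N) (leqnn 2)) _.
have -> : weight (nseq (size w) 1%N) 1 = (iter (size w) (bstep n 1) 'X).[1].
  rewrite -pairing_horner -[LHS]pairingX /T_weight -pairing_foldr.
  by congr pairing; elim: (size w) => //= r ->.
have := @iter_bstepX_le R n (size w) 1; rewrite ltr01 lexx => /(_ isT).
by rewrite mulrC ler_pdivlMr ?exprn_gt0// mul1r mulrC.
Qed.

Lemma Tval_le_ones w : all (leq 1) w -> Tval w <= Tval (nseq (size w) 1%N).
Proof.
move=> w1; have := weight_le_ones (i := 0) w1 (leqnn 1) (leqnn 1).
by rewrite !expr1n !mul1r !TvalE.
Qed.

Lemma Tval_nseq1 r : Tval (nseq r 1%N) = (ones R n r).[1].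
Proof. by rewrite /T_value tpoly_nseq. Qed.

Lemma Tval_le w : all (leq 1) w -> Tval w <= supeta.
Proof.
move=> /Tval_le_ones/le_trans; apply; rewrite Tval_nseq1.
by apply: ones_le; rewrite ltr01 lexx.
Qed.

Lemma pairing_sub_le (p : {poly R}) a : (forall i, 0 <= p`_i) -> p`_0 = 1 ->
  (forall i, (1 <= i)%N -> a i <= a 1%N) ->
  pairing p a <= a 0%N + a 1%N * (p.[1] - 1).
Proof.
move=> p0 p01 a1.
rewrite -[p in pairing p _](subrK 1) pairingD pairing1 addrC lerD2l.
have -> : p.[1] - 1 = (p - 1).[1] by rewrite hornerD hornerN hornerC.
rewrite -pairing_cst; apply: le_pairing => -[|i]; rewrite coefB coef1/=.
  by rewrite p01 subrr !mul0r.
by rewrite subr0 ler_wpM2l// a1.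
Qed.

(** The constant coefficient 1 of the suffix polynomial contributes [Tval w]. The others sum to
    [Tval u - 1], and their weights are at most [weight w 1] by monotonicity. *)
Lemma Tval_cat_le w u : Tval (w ++ u) <= Tval w + weight w 1 * (Tval u - 1).
Proof.
rewrite Tval_cat [Tval w]TvalE; apply: pairing_sub_le.
- exact: tpoly_ge0.
- exact: tpoly_coef0.
- by move=> i; exact: weight_nonincr.
Qed.

(** Every coefficient but the constant one is divided by at least [2^k], and before division the
    coefficients sum to at most [(n+1) * supeta]. *)
Lemma Tval_cons_le k u : all (leq 1) u -> (1 <= k)%N ->
  Tval (k :: u) <= 1 + n.+1%:R * supeta / 2 ^+ k.
Proof.
move=> u1 k1; rewrite -lerBlDl.
have -> : Tval (k :: u) - 1 = pairing (tpoly (k :: u) - 1) (fun=> 1).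
  by rewrite pairing_horner hornerD hornerN hornerC.
apply: (@le_trans _ _ (pairing (tpoly u * geo R n) (fun=> (2 ^+ k)^-1))); last first.
  rewrite pairing_cst mulrC hornerM ler_wpM2r ?invr_ge0 ?exprn_ge0// mulrC.
  have -> : (geo R n).[1] = n.+1%:R.
    rewrite geoE horner_sum; under eq_bigr do rewrite hornerXn expr1n.
    by rewrite sumr_const card_ord.
  by rewrite ler_wpM2l// Tval_le.
apply: le_pairing => -[|i].
  rewrite mulr1 coefB tpoly_coef0 coef1 subrr mulr_ge0 ?invr_ge0 ?exprn_ge0//.
  by rewrite coefM big_ord1 tpoly_coef0 coef_geo mul1r.
rewrite mulr1 coefB coef1 subr0 /= coef_ddiv; apply: ler_pM => //.
- rewrite coefM sumr_ge0// => j _; rewrite mulr_ge0 ?tpoly_ge0// coef_geo.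
  exact: ler0n.
- by rewrite lef_pV2 ?posrE ?exprn_gt0// lerXn2r ?nnegrE// ler_nat.
Qed.

Lemma T_truncE k r : T_trunc R n k r = Tval (mkseq k r).
Proof. exact: T_Tval. Qed.

Lemma T_trunc_nd k : nondecreasing_seq (T_trunc R n k).
Proof.
by move=> r s rs; rewrite !T_truncE -(subnKC rs) mkseqD Tval_ge.
Qed.

Lemma That_all k r : That k -> all (leq 1) (mkseq k r).
Proof. by move=> hk; exact: all_mkseq. Qed.

Lemma is_cvg_T_trunc k : That k -> cvgn (T_trunc R n k).
Proof.
move=> hk; apply: nondecreasing_is_cvgn; first exact: T_trunc_nd.
by exists supeta => _ [r _ <-]; rewrite T_truncE Tval_le ?That_all.
Qed.

Lemma Tval_le_eta k r : That k -> Tval (mkseq k r) <= eta k.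
Proof.
move=> hk; rewrite -T_truncE; apply: nondecreasing_cvgn_le.
- exact: T_trunc_nd.
- exact: is_cvg_T_trunc.
Qed.

Lemma eta_le k r b : That k ->
  (forall s, Tval (mkseq k r ++ mkseq (fun i => k (r + i)%N) s) <= b) -> eta k <= b.
Proof.
move=> hk h; apply: limr_le; first exact: is_cvg_T_trunc.
near=> m; have rm : (r <= m)%N by near: m; exact: nbhs_infty_ge.
by rewrite T_truncE -(subnKC rm) mkseqD; exact: h.
Unshelve. all: by end_near. Qed.

Lemma eta_le_supeta k : That k -> eta k <= supeta.
Proof.
move=> hk; apply: (@eta_le _ 0) => // s; rewrite Tval_le//=.
exact: all_mkseq.
Qed.

Lemma eta_le_weight k r : That k ->
  eta k <= Tval (mkseq k r) + weight (mkseq k r) 1 * supeta.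
Proof.
move=> hk; apply: (@eta_le _ r) => // s; apply: le_trans (Tval_cat_le _ _) _.
rewrite lerD2l ler_wpM2l ?weight_ge0// lerBlDr.
apply: (@le_trans _ _ supeta); last by rewrite lerDl ler01.
by rewrite Tval_le// all_mkseq.
Qed.

(** Refines [eta_le_weight] for coverings: before a large entry, the prefix alone already locates
    the value with the precision of the longer cylinder. *)
Lemma eta_le_digit k r : That k ->
  eta k <= Tval (mkseq k r) + weight (mkseq k r) 1 * (n.+1%:R * supeta / 2 ^+ k r).
Proof.
move=> hk; apply: (@eta_le _ r) => // s.
have X0 : 0 <= n.+1%:R * supeta / 2 ^+ k r.
  by rewrite divr_ge0 ?exprn_ge0// mulr_ge0// ltW// supeta_gt0.
apply: le_trans (Tval_cat_le _ _) _.
rewrite lerD2l ler_wpM2l ?weight_ge0// lerBlDl.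
case: s => [|s]; first by rewrite /T_value /= hornerC lerDl.
rewrite -add1n mkseqD /= addn0 /=; apply: Tval_cons_le => //.
by rewrite all_mkseq.
Qed.

Lemma eta_ones : eta (fun=> 1%N) = supeta.
Proof.
have h1 : That (fun=> 1%N) by [].
apply/eqP; rewrite eq_le eta_le_supeta//=.
apply: (@le_geometric _ _ _ (n%:R * supeta ^+ 2) 2^-1).
  by rewrite invr_ge0 ler0n /= invf_lt1// ltr1n.
move=> r; apply: le_trans (Tval_le_eta r h1).
have -> : mkseq (fun=> 1%N) r = nseq r 1%N.
  by elim: r => // r IH; rewrite mkseqSr IH -cats1 -[[:: 1%N]]/(nseq 1 1%N) -nseqD addn1.
rewrite Tval_nseq1; have := @ones_ge R n r 1; rewrite ltr01 lexx => /(_ isT).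
rewrite -/supeta mul1r exprVn; apply: le_trans.
by rewrite lerD2l lerN2 mulrAC.
Qed.

End Eta.

(** * Gaps between cylinders *)

(** Summation by parts: lowering [g N] to [g N.+1] can only decrease the left side, as the partial
    sums are nonnegative. *)
Lemma abel_ge (R : realFieldType) (c g : nat -> R) N :
  (forall i, g i.+1 <= g i) -> (forall M, 0 <= \sum_(i < M) c i) ->
  g N * \sum_(i < N) c i <= \sum_(i < N) c i * g i.
Proof.
move=> gS c0; elim: N => [|N IH]; first by rewrite !big_ord0 mulr0.
apply: (@le_trans _ _ (g N * \sum_(i < N.+1) c i)); first by rewrite ler_wpM2r.
rewrite !big_ord_recr/= mulrDr; apply: lerD => //.
by rewrite mulrC.
Qed.

Section Gap.
Context (R : realType) (n : nat).
Local Notation Tval := (T_value R n).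
Local Notation tpoly := (T_poly R n).
Local Notation weight := (T_weight R n).

Lemma sum_inv_consecutive m :
  \sum_(j < m) 2 / (j.+1%:R * j.+2%:R) = 2 - 2 / m.+1%:R :> R.
Proof.
elim: m => [|m IH]; first by rewrite big_ord0; field.
rewrite big_ord_recr/= IH -[m.+2%:R]natr1 -[m.+1%:R]natr1.
have := ler0n R m; move: (m%:R) => x x0; field.
by apply/andP; split; apply: lt0r_neq0; lra.
Qed.

(** The bound reproduces itself: its partial sum up to degree [i] telescopes to [2(i+1)/(i+2)], and
    dividing by [(i+1)^2] gives [2/((i+1)(i+2))] again. *)
Lemma tpoly_coef_le u i : all (leq 2) u ->
  (tpoly u)`_i <= 2 / (i.+1%:R * i.+2%:R).
Proof.
elim: u i => [|k u IH] i /=.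
  by move=> _; rewrite coef1; case: i => [|i] /=; rewrite ?divr_ge0//; lra.
move=> /andP[k2 /IH{}IH]; rewrite coef_bstep.
have i0 : 0 < i.+1%:R :> R by [].
apply: (@le_trans _ _ ((\sum_(j < i.+1) 2 / (j.+1%:R * j.+2%:R)) / i.+1%:R ^+ 2)).
  apply: ler_pM.
  - by apply: sumr_ge0 => j _; rewrite mulr_ge0 ?tpoly_ge0.
  - exact: invX_ge0.
  - apply: ler_sum => j _; case: leqP => _; first by rewrite mulr1.
    by rewrite mulr0 divr_ge0// mulr_ge0.
  - by rewrite lef_pV2 ?posrE ?exprn_gt0// ler_weXn2l// ler1n.
rewrite sum_inv_consecutive.
rewrite le_eqVlt; apply/orP; left; apply/eqP.
rewrite -[i.+2%:R]natr1; move: i0; move: (i.+1%:R) => x x0; field.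
by apply/andP; split; apply: lt0r_neq0; lra.
Qed.

Lemma Tval_le2 u : all (leq 2) u -> Tval u <= 2.
Proof.
move=> u2; rewrite /T_value horner_coef.
apply: (@le_trans _ _ (\sum_(i < size (tpoly u)) 2 / (i.+1%:R * i.+2%:R))).
  by apply: ler_sum => i _; rewrite expr1n mulr1 tpoly_coef_le.
by rewrite sum_inv_consecutive gerBl divr_ge0.
Qed.

Lemma Tval_cons_le2 k u :
  Tval (k :: u) <= \sum_(j < n.+1) j.+1%:R ^- k +
                   (\sum_(j < n.+1) j.+2%:R ^- k) * (Tval u - 1).
Proof.
have wE i : weight [:: k] i = \sum_(j < n.+1) (i + j).+1%:R ^- k.
  by apply: eq_bigr => j _; rewrite div1r.
by apply: le_trans (Tval_cat_le R n [:: k] u) _; rewrite TvalE !wE.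
Qed.

End Gap.

(* For [n = 1] the bound [Tval_le2] is too weak. *)
Lemma Tval_le_n1 (R : realType) u : all (leq 2) u -> T_value R 1 u <= 3 / 2.
Proof.
elim: u => [|k u IH]; first by move=> _; rewrite /T_value /= hornerC; lra.
move=> /= /andP[k2 /IH{}IH]; apply: le_trans (Tval_cons_le2 _ _ _ _) _.
rewrite !big_ord_recr !big_ord0/= !add0r expr1n invr1.
have h2 : 2%:R ^- k <= 2^-2 :> R.
  by rewrite lef_pV2 ?posrE ?exprn_gt0// ler_weXn2l// ler1n.
have h3 : 3%:R ^- k <= 3^-2 :> R.
  by rewrite lef_pV2 ?posrE ?exprn_gt0// ler_weXn2l// ler1n.
have T1 : 0 <= T_value R 1 u - 1.
  by rewrite subr_ge0; have := Tval_ge R 1 [::] u; rewrite {1}/T_value /= hornerC.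
have : (2%:R ^- k + 3%:R ^- k) * (T_value R 1 u - 1) <= (2^-2 + 3^-2) * (1 / 2).
  apply: ler_pM => //.
  - exact: lerD.
  - lra.
lra.
Qed.

(** The constant [1/12] is what the estimates give for [n = 1], where [3/2 + 5/12 = 2 - 1/12], and
    for [n = 2], where [11/6 + 13/12 = 3 - 1/12]. For larger [n] each increment adds at most
    [1/2 + 1/2] on the left. *)
Lemma Tval_cons1_le (R : realType) n u : (1 <= n)%N -> all (leq 2) u ->
  T_value R n (1%N :: u) <= n.+1%:R - 12^-1.
Proof.
move=> n1 u2; apply: le_trans (Tval_cons_le2 _ _ _ _) _.
have T1 : 0 <= T_value R n u - 1.
  by rewrite subr_ge0; have := Tval_ge R n [::] u; rewrite {1}/T_value /= hornerC.
have [n2|] := leqP 2 n; last first.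
  case: n n1 T1 => [//|[|//]] _ T1 _.
  rewrite !big_ord_recr !big_ord0/= !add0r !expr1.
  have : (2^-1 + 3^-1) * (T_value R 1 u - 1) <= (2^-1 + 3^-1) * (1 / 2).
    by rewrite ler_wpM2l//; have := Tval_le_n1 R u2; lra.
  lra.
apply: (@le_trans _ _ (\sum_(j < n.+1) j.+1%:R ^- 1 + \sum_(j < n.+1) j.+2%:R ^- 1)).
  rewrite lerD2l ler_piMr ?lerBlDr ?Tval_le2//.
  by apply: sumr_ge0 => j _; exact: invX_ge0.
have [m ->] : exists m, n = m.+2 by case: n n2 {n1 T1} => [|[|m]]// _; exists m.
elim: m => [|m IH]; first by rewrite !big_ord_recr !big_ord0/=; lra.
rewrite big_ord_recr [X in _ + X]big_ord_recr/= -[X in _ <= X - _]natr1.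
have a : m.+4%:R ^- 1 <= 2^-1 :> R by rewrite expr1 lef_pV2 ?posrE// ler_nat.
have b : m.+4.+1%:R ^- 1 <= 2^-1 :> R by rewrite expr1 lef_pV2 ?posrE// ler_nat.
move: a b IH; move: (_ ^- 1) (_ ^- 1) (m.+3%:R) => x y z.
lra.
Qed.

(** * Separation of cylinders and the order on sequences with entries at least 2 *)

Section Comparison.
Context (R : realType) (n : nat) (n1 : (1 <= n)%N).
Local Notation Tval := (T_value R n).
Local Notation tpoly := (T_poly R n).
Local Notation weight := (T_weight R n).
Local Notation eta := (eta_lim R n).

(* The coefficients of [geo - bstep 1 (tpoly u)] are nonnegative up to degree [n]
   and nonpositive beyond, so it suffices to bound their total, by
   [Tval_cons1_le]. *)
Lemma gap_partial_sums u M : all (leq 2) u ->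
  0 <= \sum_(i < M) (geo R n - bstep n 1 (tpoly u) - 12^-1 *: 'X)`_i.
Proof.
move=> u2; set c := geo R n - _ - _.
have cE i : c`_i = (i <= n)%:R - (bstep n 1 (tpoly u))`_i - 12^-1 * (i == 1%N)%:R.
  by rewrite !coefB coefZ coefX coef_geo.
have c_ge i : (i <= n)%N -> 0 <= c`_i.
  move=> i_n; rewrite cE i_n.
  have bi : (bstep n 1 (tpoly u))`_i <= (\sum_(j < i.+1) (tpoly u)`_j) / i.+1%:R.
    rewrite coef_bstep expr1 ler_wpM2r ?invr_ge0//; apply: ler_sum => j _.
    by case: leqP; rewrite ?mulr1// mulr0 tpoly_ge0.
  case: i i_n bi => [|[|i]] i_n bi.
  - move: bi; rewrite big_ord1 tpoly_coef0 /=; lra.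
  (* Degree 1: the coefficient of the step is at most [(1 + 1/3) / 2 = 2/3], which leaves room for
     [1/12]. *)
  - move: bi; rewrite !big_ord_recr big_ord0/= tpoly_coef0 add0r.
    have := tpoly_coef_le R n 1 u2; lra.
  - have h : (\sum_(j < i.+3) (tpoly u)`_j) / i.+3%:R <= 1.
      rewrite ler_pdivrMr// mul1r.
      apply: (@le_trans _ _ (\sum_(j < i.+3) 2 / (j.+1%:R * j.+2%:R))).
        by apply: ler_sum => j _; exact: tpoly_coef_le.
      rewrite sum_inv_consecutive (@le_trans _ _ 2)//; last by rewrite ler_nat.
      by rewrite gerBl divr_ge0.
    move: (le_trans bi h) => /=; lra.
have c_le i : (n < i)%N -> c`_i <= 0.
  move=> n_i; rewrite cE leqNgt n_i /=.
  have -> : (i == 1%N) = false by apply/negbTE; rewrite neq_ltn (leq_ltn_trans n1 n_i) orbT.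
  rewrite sub0r mulr0 subr0 oppr_le0; exact: (tpoly_ge0 R n (1%N :: u) i).
have [Mn|nM] := leqP M n.+1.
  by apply: sumr_ge0 => i _; apply: c_ge; rewrite -ltnS (leq_trans (ltn_ord i)).
have tot : 0 <= c.[1].
  rewrite /c !hornerD !hornerN hornerZ hornerX.
  have -> : (geo R n).[1] = n.+1%:R.
    rewrite geoE horner_sum; under eq_bigr do rewrite hornerXn expr1n.
    by rewrite sumr_const card_ord.
  have := @Tval_cons1_le R n u n1 u2; rewrite {1}/T_value /=; lra.
apply: le_trans tot _.
rewrite (@horner_coef_wide _ (M + size c)) ?leq_addl//.
under eq_bigr do rewrite expr1n mulr1.
rewrite big_split_ord/= gerDl; apply: sumr_le0 => i _; apply: c_le.
by rewrite (leq_trans _ (leq_addr _ _))// ltnW.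
Qed.

(** After reduction to [b = a+1], the difference of the two sides pairs the polynomial of
    [gap_partial_sums] with the nonincreasing sequence [g], and Abel summation applies. The
    subtracted [X / 12] yields the gap. *)
Lemma Tval_gap w a b u : (a < b)%N -> all (leq 2) u ->
  Tval (w ++ b :: u) <= Tval (rcons w a) - 12^-1 * 2 ^- a * weight w 1.
Proof.
move=> ab u2.
have -> : Tval (rcons w a) = pairing (ddiv a (geo R n)) (weight w).
  by rewrite -cats1 Tval_cat /= /bstep mul1r.
rewrite Tval_cat /=.
apply: (@le_trans _ _ (pairing (ddiv a (bstep n 1 (tpoly u))) (weight w))).
  rewrite -ddivD addn1; apply: le_pairingl; last exact: weight_ge0.
  move=> i; rewrite /bstep !coef_ddiv ler_wpM2l//.
    by rewrite coefM sumr_ge0// => j _; rewrite mulr_ge0 ?tpoly_ge0// coef_geo ler0n.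
  by rewrite lef_pV2 ?posrE ?exprn_gt0// ler_weXn2l// ler1n.
rewrite -subr_ge0.
pose g i := weight w i / i.+1%:R ^+ a.
have -> : pairing (ddiv a (geo R n)) (weight w) - 12^-1 * 2 ^- a * weight w 1 -
    pairing (ddiv a (bstep n 1 (tpoly u))) (weight w) =
    pairing (geo R n - bstep n 1 (tpoly u) - 12^-1 *: 'X) g.
  move: (bstep n 1 _) => Q.
  by rewrite !pairing_ddiv !pairingB pairingZ pairingX /g; ring.
have gS i : g i.+1 <= g i.
  apply: ler_pM; rewrite ?weight_ge0 ?weight_nonincr ?invX_ge0//.
  by rewrite lef_pV2 ?posrE ?exprn_gt0// lerXn2r ?nnegrE// ler_nat.
apply: le_trans (abel_ge _ gS _) => [|M]; last exact: gap_partial_sums.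
rewrite mulr_ge0 ?gap_partial_sums//.
by rewrite mulr_ge0 ?weight_ge0 ?invX_ge0.
Qed.

Lemma That2_That k : That2 k -> That k.
Proof. by move=> h i; exact: ltnW (h i). Qed.

(** The value of the prefix of [k] of length [r.+1] is a lower bound for [eta k], and [Tval_gap]
    puts the truncations of [l] below it by the stated margin. *)
Lemma eta_gap k l r : That k -> That2 l -> (forall i, (i < r)%N -> k i = l i) ->
  (k r < l r)%N ->
  eta l <= eta k - 12^-1 * 2 ^- (k r) * weight (mkseq k r) 1.
Proof.
move=> hk hl kl klr; have hl' := That2_That hl.
have kE : mkseq k r = mkseq l r.
  by apply/eq_in_map => i; rewrite mem_iota => /kl.
apply: (@eta_le _ _ _ r.+1 _ hl') => s.
have := Tval_gap (mkseq k r) klr (all_mkseq s (fun i => hl (r.+1 + i)%N)).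
rewrite kE mkseqSr cat_rcons => /le_trans; apply; rewrite -kE -mkseqSr lerD2r.
exact: Tval_le_eta.
Qed.

Lemma eta_lt k l : That2 k -> That2 l -> seq_succ k l -> eta l < eta k.
Proof.
move=> hk hl [r [kl klr]].
apply: le_lt_trans (eta_gap (That2_That hk) hl kl klr) _.
by rewrite ltrBlDr ltrDl !mulr_gt0 ?invr_gt0 ?exprn_gt0 ?weight_gt0.
Qed.

Lemma seq_succ_total k l : [\/ k = l, seq_succ k l | seq_succ l k].
Proof.
have [e|ne] := pselect (k = l); first by constructor 1.
have ex : exists i, k i != l i.
  by apply: contrapT => h; apply: ne; apply/funext => i; apply/eqP/negPn/negP => h';
    apply: h; exists i.
have kl i : (i < ex_minn ex)%N -> k i = l i.
  case: ex_minnP => m _ mmin im; apply/eqP/negPn/negP => h.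
  by have := mmin _ h; rewrite leqNgt im.
have : k (ex_minn ex) != l (ex_minn ex) by case: ex_minnP.
rewrite neq_ltn => /orP[h|h].
  by constructor 2; exists (ex_minn ex).
by constructor 3; exists (ex_minn ex); split => // i /kl.
Qed.

Lemma eta_ltE k l : That2 k -> That2 l -> (eta l < eta k <-> seq_succ k l).
Proof.
move=> hk hl; split; last exact: eta_lt.
have [->|//|/eta_lt h lt] := seq_succ_total k l; first by rewrite ltxx.
by have := lt_trans lt (h hl hk); rewrite ltxx.
Qed.

End Comparison.

(** * Overlapping cylinders and the image *)

Section Image.
Context (R : realType) (n : nat) (n1 : (1 <= n)%N).
Local Notation Tval := (T_value R n).
Local Notation tpoly := (T_poly R n).
Local Notation weight := (T_weight R n).
Local Notation eta := (eta_lim R n).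
Local Notation rho := (n%:R / n.+1%:R : R).

Lemma rho_itv : 0 <= rho < 1.
Proof. by rewrite divr_ge0//= ltr_pdivrMr// mul1r ltr_nat. Qed.

(** In degree [m <= n] a step averages the coefficients of degrees 0 to [m]. The constant one is
    exactly 1, so the defect shrinks by [m/(m+1) <= n/(n+1)]. *)
Lemma ones_coef_ge r m : (m <= n)%N -> 1 - rho ^+ r <= (ones R n r)`_m.
Proof.
have /andP[rho0 rho1] := rho_itv.
have onesE s : ones R n s = tpoly (nseq s 1%N) by rewrite tpoly_nseq.
elim: r m => [|r IH] m mn; first by rewrite expr0 subrr onesE tpoly_ge0.
rewrite /ones iterS -/(ones R n r) coef_bstep expr1 ler_pdivlMr//.
have -> : \sum_(j < m.+1) (ones R n r)`_j * (m - j <= n)%:R =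
          \sum_(j < m.+1) (ones R n r)`_j.
  by apply: eq_bigr => j _; rewrite (leq_trans (leq_subr _ _) mn) mulr1.
rewrite big_ord_recl onesE tpoly_coef0 -onesE.
apply: (@le_trans _ _ (1 + \sum_(j < m) (1 - rho ^+ r))); last first.
  by rewrite lerD2l; apply: ler_sum => j _; apply: IH; exact: leq_trans (ltn_ord j) mn.
rewrite sumr_const card_ord -[_ *+ m]mulr_natr -[m.+1%:R]natr1 exprS.
have h : m%:R <= rho * (m%:R + 1) :> R.
  rewrite natr1 mulrAC ler_pdivlMr// -!natrM ler_nat mulnC.
  by rewrite !mulSn mulnS mulnC leq_add2r.
have : m%:R * rho ^+ r <= rho * (m%:R + 1) * rho ^+ r by rewrite ler_wpM2r ?exprn_ge0.
by move: (rho) (rho ^+ r) (m%:R : R) => z t x; lra.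
Qed.

Lemma ones_coefS_ge r : (1 - rho ^+ r) / n.+2%:R <= (ones R n r.+1)`_n.+1.
Proof.
have onesE s : ones R n s = tpoly (nseq s 1%N) by rewrite tpoly_nseq.
rewrite /ones iterS -/(ones R n r) coef_bstep expr1 ler_wpM2r ?invr_ge0//.
apply: le_trans (ones_coef_ge r (leqnn n)) _.
(* Only the term [j = n] is kept; its step 1 is allowed since [n >= 1]. *)
rewrite (bigD1 (inord n))//= inordK// subSnn n1 mulr1 lerDl.
by apply: sumr_ge0 => j _; rewrite mulr_ge0// onesE tpoly_ge0.
Qed.

Definition append_ones (w : seq nat) : nat -> nat := nth 1%N w.

Lemma That_ext w : all (leq 1) w -> That (append_ones w).
Proof.
move=> /all_nthP-/(_ 1%N) w1 i; rewrite /append_ones.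
by have [/w1//|/(nth_default 1%N)->] := ltnP i (size w).
Qed.

Lemma mkseq_ext w : mkseq (append_ones w) (size w) = w.
Proof. exact: mkseq_nth. Qed.

Lemma mkseq_extD w r : mkseq (append_ones w) (size w + r) = w ++ nseq r 1%N.
Proof.
rewrite mkseqD mkseq_ext; congr cat.
elim: r => // r IH; rewrite mkseqSr IH /append_ones nth_default ?leq_addr//.
by rewrite -cats1 -[[:: 1%N]]/(nseq 1 1%N) -nseqD addn1.
Qed.

(* Since [bstep k.+1 (ones r) = ddiv k (ones r.+1)] and [bstep k 1 = ddiv k geo],
   the two cylinders overlap because [ones r] tends coefficientwise to
   [exp (logphi)], whose coefficients are 1 up to degree [n] and positive beyond. *)
Lemma Tval_lt_eta_ext w k : all (leq 1) w ->
  Tval (rcons w k) < eta (append_ones (rcons w k.+1)).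
Proof.
(* [g] is a contribution of degree [n+1], absent from [geo], where the iterates have a coefficient
   asymptotically at least [1/(n+2)]. *)
move=> w1; pose g := weight w n.+1 / n.+2%:R ^+ k / n.+2%:R.
have g0 : 0 < g by rewrite !mulr_gt0 ?invr_gt0 ?exprn_gt0 ?weight_gt0.
suff h : Tval (rcons w k) + g <= eta (append_ones (rcons w k.+1)).
  by apply: lt_le_trans h; rewrite ltrDl.
have /andP[rho0 rho1] := rho_itv.
apply: (@le_geometric _ _ _ (Tval (rcons w k) + g) rho rho_itv) => r.
rewrite -{1}[_ + g]mulr1 -mulrBr.
have v1 : all (leq 1) (rcons w k.+1) by rewrite all_rcons.
have := Tval_le_eta R n (size (rcons w k.+1) + r) (That_ext v1).
rewrite mkseq_extD; apply: le_trans.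
rewrite cat_rcons Tval_cat -cats1 Tval_cat.
pose q := geo R n + n.+2%:R^-1 *: 'X^(n.+1).
have -> : pairing (tpoly [:: k]) (weight w) + g = pairing (ddiv k q) (weight w).
  rewrite /= /bstep mul1r !pairing_ddiv pairingD pairingZ /g.
  have -> (a : nat -> R) : pairing 'X^(n.+1) a = a n.+1.
    by rewrite -['X^_]mul1r pairing_mulXn pairing1.
  by congr (_ + _); rewrite mulrC.
rewrite mulrC -pairingZ /T_poly; apply: le_pairingl; last exact: weight_ge0.
have -> : foldr (bstep n) 1 (k.+1 :: nseq r 1%N) = ddiv k (ones R n r.+1).
  by rewrite /ones iterS -tpoly_nseq /= {1}/bstep -[k.+1]addn1 ddivD.
have hA i := @ones_coef_ge r.+1 i; have hB := ones_coefS_ge r.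
have hC i : 0 <= (ones R n r.+1)`_i by rewrite /ones -tpoly_nseq tpoly_ge0.
move: (ones R n r.+1) hA hB hC => p hA hB hC.
move=> i; rewrite coefZ !coef_ddiv mulrA ler_wpM2r ?invX_ge0//.
rewrite /q coefD coef_geo coefZ coefXn.
have r0 : rho ^+ r <= 1 by rewrite exprn_ile1// ltW.
have [i_n|] := leqP i n.
  rewrite (_ : (i == n.+1) = false) ?mulr0 ?addr0 ?mulr1; last first.
    by apply/negbTE; rewrite neq_ltn ltnS i_n.
  apply: le_trans (hA i i_n).
  by rewrite lerD2l lerN2 exprS ler_piMl ?exprn_ge0// ltW.
rewrite leq_eqVlt => /orP[/eqP <-|n_i].
  by rewrite eqxx add0r mulr1.
rewrite (_ : (i == n.+1) = false) ?mulr0 ?addr0; last first.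
  by apply/negbTE; rewrite neq_ltn n_i orbT.
by rewrite mulr0.
Qed.

Lemma eta_gt1 k : That k -> 1 < eta k.
Proof.
move=> hk; apply: lt_le_trans (Tval_le_eta R n 1 hk).
have T0 : Tval [::] = 1 by rewrite /T_value /= hornerC.
have := Tval_rcons_sub R n [::] (k 0%N).
rewrite T0 -[rcons _ _]/(mkseq k 1) -subr_gt0 => ->.
case: n n1 => // m _; rewrite big_ord_recl ltr_pwDl//.
  by rewrite mulr_gt0 ?weight_gt0 ?invX_gt0.
by apply: sumr_ge0 => i _; rewrite mulr_ge0 ?weight_ge0 ?invX_ge0.
Qed.

(** Lowering the entry [k s] to 1 raises the truncations by a fixed amount: the passage from index 0
    to index 1 then weighs [weight w 1 / 2] instead of at most [weight w 1 / 4]. The raised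
    truncations are still at most [supeta]. *)
Lemma eta_lt_supeta k s : That k -> (2 <= k s)%N -> eta k < supeta R n.
Proof.
move=> hk ks2; set w := mkseq k s.
apply: (@le_lt_trans _ _ (supeta R n - weight w 1 / 4)); last first.
  by rewrite ltrBlDr ltrDl divr_gt0 ?weight_gt0.
apply: (@eta_le _ _ _ s.+1 _ hk) => r; set u := mkseq _ r.
rewrite mkseqSr cat_rcons -/w.
have u1 : all (leq 1) u by apply: all_mkseq.
have w1 : all (leq 1) w by apply: all_mkseq.
have := Tval_le (w := w ++ 1%N :: u) R n; rewrite all_cat w1 /= u1 => /(_ isT) h.
apply: (@le_trans _ _ (Tval (w ++ 1%N :: u) - weight w 1 / 4)); last by rewrite lerD2r.
rewrite !Tval_rcons_cat lerBrDr.
pose b i := wstep n (k s) (weight w) i + (i == 0%N)%:R * (weight w 1 / 4).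
have -> : pairing (tpoly u) (wstep n (k s) (weight w)) + weight w 1 / 4 =
          pairing (tpoly u) b.
  rewrite -[X in _ + X = _](_ : pairing (tpoly u) (fun i => (i == 0%N)%:R * (weight w 1 / 4)) = _).
    by rewrite /pairing -big_split; apply: eq_bigr => i _; rewrite /b mulrDr.
  rewrite /pairing; case E: (size _) => [|m].
    have := tpoly_coef0 R n u; move/eqP: E; rewrite size_poly_eq0 => /eqP ->.
    by rewrite coef0 => /eqP; rewrite eq_sym oner_eq0.
  rewrite big_ord_recl /= big1 ?addr0; last by move=> i _; rewrite mul0r mulr0.
  by rewrite tpoly_coef0 !mul1r.
apply: le_pairing => i; rewrite ler_wpM2l ?tpoly_ge0//.
have wk j m : weight w j / m.+1%:R ^+ k s <= weight w j / m.+1%:R ^+ 1.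
  rewrite ler_wpM2l ?weight_ge0// lef_pV2 ?posrE ?exprn_gt0//.
  by rewrite ler_weXn2l// ler1n.
rewrite /b; case: i => [|i] /=; last first.
  by rewrite mul0r addr0; apply: ler_sum => j _; exact: wk.
(* [n >= 1] exposes the term [j = 1] at index 0, the source of the gain. *)
case: n n1 @w h w1 b wk => // m _ w _ _ _ wk.
rewrite /wstep big_ord_recl [leRHS]big_ord_recl big_ord_recl [X in _ <= _ + X]big_ord_recl.
rewrite mul1r.
have h2 : T_weight R m.+1 w 1 / 2%:R ^+ k s <= T_weight R m.+1 w 1 / 2 ^+ 2.
  rewrite ler_wpM2l ?weight_ge0// lef_pV2 ?posrE ?exprn_gt0//.
  by rewrite ler_weXn2l// ler1n.
have h0 := wk 0%N 0%N.
have hs : \sum_(i < m) T_weight R m.+1 w (0 + lift ord0 (lift ord0 i)) /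
            (0 + lift ord0 (lift ord0 i)).+1%:R ^+ k s <=
          \sum_(i < m) T_weight R m.+1 w (0 + lift ord0 (lift ord0 i)) /
            (0 + lift ord0 (lift ord0 i)).+1%:R ^+ 1.
  by apply: ler_sum => j _; exact: wk.
move: hs h0 h2; rewrite /= !add0n !expr1 -[bump 0 0]/1%N.
move: (\sum_(i < m) _) (\sum_(i < m) _) => A B; lra.
Qed.

(** Each entry is the least [k] with [Tval (rcons w k) < y]; by overlap, [y] stays below the top
    [eta (append_ones w)] of the cylinder. If the entries were 1 after a last larger [k s], then [y]
    would be at most the value with last entry [k s - 1], which is less than [eta k = y]. *)
Lemma eta_greedy y : 1 < y <= supeta R n ->
  exists k, [/\ That k, ~ ThatR k & eta k = y].
Proof.
move=> /andP[y1 ysup].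
pose P w k := k = 1%N \/ y <= Tval (rcons w k.-1).
pose I w := all (leq 1) w /\ Tval w < y <= eta (append_ones w).
have [||k kP] := @nested_choice P I.
- split => //; rewrite {1}/T_value /= hornerC y1/=.
  have -> : append_ones [::] = fun=> 1%N by apply/funext => i; rewrite /append_ones nth_nil.
  by rewrite eta_ones.
- move=> w [w1 /andP[wy yw]].
  (* Such an entry exists because [Tval (rcons w k)] tends to [Tval w < y] as [k] grows. *)
  have ex : exists k, (1 <= k)%N && (Tval (rcons w k) < y).
    apply: contrapT => nex.
    have : y <= Tval w.
      apply: (@le_geometric _ _ _ (weight w 1 * (n.+1%:R * supeta R n)) 2^-1).
        by rewrite invr_ge0 ler0n /= invf_lt1// ltr1n.
      move=> r; have : y <= Tval (rcons w r.+1).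
        by rewrite leNgt; apply/negP => h; apply: nex; exists r.+1.
      have h1 := Tval_cat_le R n w [:: r.+1].
      have h2 := @Tval_cons_le R n r.+1 [::] isT isT.
      have h3 : weight w 1 * (Tval [:: r.+1] - 1) <=
                weight w 1 * (n.+1%:R * supeta R n / 2 ^+ r).
        rewrite ler_wpM2l ?weight_ge0// lerBlDl; apply: le_trans h2 _.
        rewrite lerD2l ler_wpM2l ?mulr_ge0 ?(ltW (supeta_gt0 _ _))//.
        by rewrite lef_pV2 ?posrE ?exprn_gt0// ler_weXn2l// ler1n.
      move: h1 h3; rewrite cats1 exprVn; lra.
    by rewrite leNgt wy.
  case: (ex_minnP ex) => k /andP[k1 ky] kmin.
  have [k_le|k_gt] := leqP k 1.
    exists k; have k1' : k = 1%N by apply/eqP; rewrite eqn_leq k_le.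
    split; first by left.
    rewrite /I all_rcons k1 ky w1; split => //=.
    rewrite k1' (_ : append_ones (rcons w 1%N) = append_ones w)//; apply/funext => i.
    rewrite /append_ones nth_rcons; case: ltnP => // wi; rewrite nth_default//.
    by case: eqP.
  have yk : y <= Tval (rcons w k.-1).
    rewrite leNgt; apply/negP => h.
    have := kmin k.-1; rewrite h andbT -ltnS (ltn_predK k1) => /(_ k_gt).
    by rewrite leqNgt ltn_predL k1.
  exists k; split; first by right.
  rewrite /I all_rcons k1 ky w1; split => //=; apply: (le_trans yk).
  by rewrite -{2}(ltn_predK k1) ltW// Tval_lt_eta_ext.
exists k.
have hk : That k.
  by move=> i; have [[+ _] _] := kP i.+1; rewrite mkseqSr all_rcons => /andP[].
have ey : eta k = y.
  apply/eqP; rewrite eq_le; apply/andP; split.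
    apply: (@eta_le _ _ _ 0 _ hk) => s /=.
    by have [[_ /andP[/ltW]]] := kP s.
  (* The bounds on the cylinder of length [r] hold for both [y] and [eta k], and they differ by at
     most [supeta^3 / 2^r]. *)
  apply: (@le_geometric _ _ _ (supeta R n ^+ 3) 2^-1).
    by rewrite invr_ge0 ler0n /= invf_lt1// ltr1n.
  move=> r; have [[w1 /andP[_ yw]] _] := kP r; set w := mkseq k r in w1 yw.
  have h1 := eta_le_weight R n (size w) (That_ext w1); rewrite mkseq_ext in h1.
  have h2 := Tval_le_eta R n r hk; rewrite -/w in h2.
  have h3 : weight w 1 * supeta R n <= supeta R n ^+ 3 * 2^-1 ^+ r.
    rewrite exprSr mulrAC ler_wpM2r ?(ltW (supeta_gt0 _ _))//.
    apply: le_trans (weight1_le R n w1) _.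
    rewrite exprVn ler_wpM2l ?exprn_ge0 ?(ltW (supeta_gt0 _ _))//.
    rewrite lef_pV2 ?posrE ?exprn_gt0// ler_weXn2l ?ler1n//.
    rewrite -{1}(size_mkseq k r) -/w.
    by elim: (w) w1 => //= a v IH /andP[a1 /IH]; rewrite -add1n; exact: leq_add.
  move: h1 h2 h3 yw; lra.
split => // -[_ [s [ks2 k_tail]]].
have [_ Ps] := kP s; case: Ps => [ks1|]; first by rewrite ks1 in ks2.
have ext_k : append_ones (rcons (mkseq k s) (k s)) = k.
  apply/funext => i; rewrite /append_ones -mkseqSr.
  have [is'|si] := ltnP i s.+1; first by rewrite nth_mkseq.
  by rewrite nth_default ?size_mkseq// k_tail.
have := @Tval_lt_eta_ext (mkseq k s) (k s).-1 (That_all s hk).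
rewrite (ltn_predK ks2) ext_k ey => lt le.
by have := lt_le_trans lt le; rewrite ltxx.
Qed.

End Image.

(** * Hausdorff measure *)

Section Hausdorff.
Context (R : realType).
Implicit Types (U A : set R) (s d : R).

Lemma le_diameter U x y : U x -> U y -> (`|x - y|%:E <= diameter U)%E.
Proof. by move=> Ux Uy; apply: ereal_sup_ubound; exists (x, y). Qed.

Lemma diameter_le U d : (forall x y, U x -> U y -> `|x - y| <= d) ->
  (diameter U <= d%:E)%E.
Proof.
by move=> h; apply: ge_ereal_sup => _ [[x y] [/= Ux Uy] <-]; rewrite lee_fin h.
Qed.

Lemma diameter_ge0 U x : U x -> (0 <= diameter U)%E.
Proof. by move=> Ux; apply: le_trans (le_diameter Ux Ux); rewrite lee_fin. Qed.

Lemma hausdorff_gauge_ge0 s U : (0 <= hausdorff_gauge s U)%E.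
Proof. by rewrite /hausdorff_gauge; case: ifP => // _; exact: poweR_ge0. Qed.

Lemma hausdorff_gauge0 s : hausdorff_gauge s (set0 : set R) = 0%E.
Proof. by rewrite /hausdorff_gauge asboolT. Qed.

Lemma hausdorff_gaugeE s U x : U x -> hausdorff_gauge s U = (diameter U `^ s)%E.
Proof.
by move=> Ux; rewrite /hausdorff_gauge asboolF// => U0; rewrite U0 in Ux.
Qed.

Lemma hausdorff_gauge_le s d U : 0 <= s -> 0 <= d -> (diameter U <= d%:E)%E ->
  (hausdorff_gauge s U <= (d `^ s)%:E)%E.
Proof.
move=> s0 d0 Ud; have [->|/set0P[x Ux]] := eqVneq U set0.
  by rewrite hausdorff_gauge0 lee_fin powR_ge0.
rewrite (hausdorff_gaugeE _ Ux) -poweR_EFin; apply: gt0_ler_poweR => //.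
- by rewrite in_itv/= leey (diameter_ge0 Ux).
- by rewrite in_itv/= leey lee_fin d0.
Qed.

Lemma hausdorff_premeasure_ge0 s d A : (0 <= hausdorff_premeasure s d A)%E.
Proof.
apply: le_ereal_inf_tmp => _ [U _ <-].
by apply: nneseries_ge0 => i _ _; exact: hausdorff_gauge_ge0.
Qed.

Lemma hausdorff_premeasure_le s d delta N (U : nat -> set R) A :
  0 <= s -> 0 <= d <= delta ->
  (forall i, (i < N)%N -> (diameter (U i) <= d%:E)%E) ->
  A `<=` \bigcup_(i in [set i | (i < N)%N]) U i ->
  (hausdorff_premeasure s delta A <= (N%:R * d `^ s)%:E)%E.
Proof.
move=> s0 /andP[d0 dd] Ud AU.
(* The cover is padded with empty sets, whose gauge is 0 even for [s = 0]. *)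
pose V i := if (i < N)%N then U i else set0.
apply: (@le_trans _ _ (\sum_(0 <= i <oo) hausdorff_gauge s (V i))%E).
  apply: ereal_inf_lbound; exists V => //; split=> [i|x /AU[i /= iN Uix]].
    rewrite /V; case: ifP => [/Ud/le_trans|_]; first by apply; rewrite lee_fin.
    by apply: diameter_le => x y [].
  by exists i => //; rewrite /V iN.
rewrite (@nneseries_split _ _ 0 N); last by move=> *; exact: hausdorff_gauge_ge0.
rewrite add0n [X in (_ + X)%E]eseries0 ?adde0; last first.
  by move=> i Ni _; rewrite /V ltnNge Ni /= hausdorff_gauge0.
rewrite big_mkord -[N in N%:R]card_ord mulr_natl -sumr_const -sumEFin.
apply: lee_sum => i _; rewrite /V ltn_ord.
by apply: hausdorff_gauge_le => //; exact: Ud.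
Qed.

(* The covering form of "a Hoelder image of a null set is null": [C] is the graph
   of a [t]-Hoelder surjection from a part of [A] onto an interval of length [b]. *)
Lemma hausdorff_premeasure_ge (C : R -> R -> Prop) A s t b D :
  0 <= s <= t -> 0 < t -> 0 < b -> 0 < D ->
  (forall y, 0 < y <= b -> exists2 x, A x & C y x) ->
  (forall y y' x x', C y x -> C y' x' -> `|y - y'| <= D * `|x - x'| `^ t) ->
  ((b / (2 * D))%:E <= hausdorff_premeasure s 1 A)%E.
Proof.
move=> /andP[s0 st] t0 b0 D0 surj holder.
have DD : 0 < 2 * D by rewrite mulr_gt0.
apply: le_ereal_inf_tmp => _ [U [U1 AU] <-].
rewrite mulrC EFinM lee_pdivrMl//.
(* If [C] relates some [y0] to a point of [U i], then [J] is the interval around [y0] of radius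
   [D d^t], with [d] the diameter of [U i]. Its length is at most [2 D d^s] because [d <= 1] and
   [s <= t]. *)
pose Q i (J : set R) := [/\ measurable J, forall y x, U i x -> C y x -> J y &
  (lebesgue_measure J <= (2 * D)%:E * hausdorff_gauge s (U i))%E].
have [J JP] : {J : nat -> set R & forall i, Q i (J i)}.
  apply: (@boolp.choice _ _ Q) => i.
  have [[y0 [x0 [Ux0 Cy0]]]|no] := pselect (exists y x, U i x /\ C y x); last first.
    exists set0; split => //; first by move=> y x Ux Cyx; apply: no; exists y, x.
    by rewrite measure0 mule_ge0 ?hausdorff_gauge_ge0// lee_fin ltW.
  have dfin : diameter (U i) \is a fin_num.
    by rewrite ge0_fin_numE ?(diameter_ge0 Ux0)// (le_lt_trans (U1 i)) ?ltry.
  pose d := fine (diameter (U i)).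
  have dE : d%:E = diameter (U i) by rewrite fineK.
  have d0 : 0 <= d by rewrite fine_ge0// (diameter_ge0 Ux0).
  have d1 : d <= 1 by rewrite -lee_fin dE.
  pose L := D * d `^ t.
  have L0 : 0 <= L by rewrite mulr_ge0 ?powR_ge0// ltW.
  exists `[y0 - L, y0 + L]%classic; split.
  - exact: measurable_itv.
  - move=> y x Ux Cyx.
    rewrite /= in_itv /= -ler_distlC; apply: (le_trans (holder _ _ _ _ Cy0 Cyx)).
    rewrite ler_wpM2l ?(ltW D0)// ge0_ler_powR ?(ltW t0)// ?nnegrE//.
    by rewrite -lee_fin dE le_diameter.
  - rewrite lebesgue_measure_itv /= lte_fin (hausdorff_gaugeE _ Ux0) -dE poweR_EFin.
    have h : d `^ t <= d `^ s.
      (* At [d = 0] the left side vanishes as [t > 0], while the right side is 1 when [s = 0]. *)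
      have [->|dn0] := eqVneq d 0.
        by rewrite powR0 ?powR_ge0// gt_eqF.
      by apply: ger_powR => //; rewrite d1 lt0r dn0 d0.
    case: ifP => _; last by rewrite lee_fin mulr_ge0 ?powR_ge0// ltW.
    rewrite -EFinB -EFinM lee_fin.
    have : D * d `^ t <= D * d `^ s by rewrite ler_wpM2l// ltW.
    rewrite /L; lra.
have mJ i : measurable (J i) by have [] := JP i.
apply: (@le_trans _ _ (lebesgue_measure `]0, b]%classic)).
  by rewrite lebesgue_measure_itv /= lte_fin b0 sube0.
have sub : (lebesgue_measure (`]0%R, b]%classic : set R) <=
    \sum_(0 <= i <oo) lebesgue_measure (J i))%E.
  apply: measure_sigma_subadditive => //.
  move=> y /=; rewrite in_itv /= => /surj[x /AU[i _ Uix] Cyx].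
  by exists i => //; have [_ + _] := JP i; apply; eauto.
apply: (le_trans sub); rewrite -nneseriesZl; last by move=> i _; exact: hausdorff_gauge_ge0.
by apply: lee_nneseries => // i _; have [] := JP i.
Qed.

End Hausdorff.

(** * The dimension *)

Definition incr_head (w : seq nat) : seq nat :=
  if w is k :: v then k.+1 :: v else [::].

(** Words with entries at least 2 and sum at most [m], split by whether the first entry is 2.
    [incr_head] fixes the empty word, which thus survives at each level; the lengths follow the
    Fibonacci recursion. *)
Fixpoint words (m : nat) : seq (seq nat) :=
  match m with
  | 0 | 1 => [:: [::]]
  | (m'.+1 as m1).+1 => map incr_head (words m1) ++ map (cons 2) (words m')
  end.

Lemma words_rec m : words m.+2 = map incr_head (words m.+1) ++ map (cons 2) (words m).
Proof. by []. Qed.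

Lemma mem_words m w : all (leq 2) w -> (sumn w <= m)%N -> w \in words m.
Proof.
suff h : forall m, (forall w, all (leq 2) w -> (sumn w <= m)%N -> w \in words m) /\
    (forall w, all (leq 2) w -> (sumn w <= m.+1)%N -> w \in words m.+1).
  exact: (h m).1.
move=> {m w}; elim=> [|m [IH0 IH1]].
  split=> -[|k w] //= /andP[k2 _]; have k0 : (1 < k + sumn w)%N by rewrite ltn_addr.
  - by move=> /(leq_trans k0).
  - by move=> /(leq_trans k0); rewrite ltnn.
split=> // -[|k w] w2 ws; rewrite words_rec mem_cat.
  by apply/orP; left; apply/mapP; exists [::] => //; exact: IH1.
move: w2 ws => /= /andP[k2 w2] ws.
have [k_le|k_gt] := leqP k 2.
  have k2' : k = 2 by apply/eqP; rewrite eqn_leq k_le.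
  apply/orP; right; apply/mapP; exists w; last by rewrite k2'.
  by apply: IH0 => //; move: ws; rewrite k2' add2n !ltnS.
apply/orP; left; apply/mapP; exists (k.-1 :: w); last by rewrite /= (ltn_predK k2).
apply: IH1 => /=; first by rewrite w2 andbT -ltnS (ltn_predK k2).
by move: ws; rewrite -{1}(ltn_predK k2) addSn ltnS.
Qed.

(** * Expansions in the golden base *)

Section Golden.
Context (R : realType).

Definition golden : R := (1 + Num.sqrt 5) / 2.

Definition eta_dim : R := ln golden / ln 2.

Lemma goldenE : golden ^+ 2 = golden + 1.
Proof.
have := sqr_sqrtr (ler0n R 5); rewrite /golden expr2; lra.
Qed.

Lemma golden_gt1 : 1 < golden.
Proof.
have : (1 : R) < Num.sqrt 5 by rewrite -{1}sqrtr1 ltr_sqrt// ltr1n.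
by rewrite /golden; lra.
Qed.

Lemma golden_gt0 : 0 < golden.
Proof. exact: lt_trans ltr01 golden_gt1. Qed.

Lemma ln2_gt0 : 0 < ln (2 : R).
Proof. by rewrite ln_gt0// ltr1n. Qed.

Lemma dim_gt0 : 0 < eta_dim.
Proof. by rewrite divr_gt0 ?ln_gt0 ?golden_gt1 ?ltr1n. Qed.

Lemma powR2_dim : 2 `^ eta_dim = golden :> R.
Proof.
rewrite /powR pnatr_eq0 /= /eta_dim mulfVK ?lnK ?posrE ?golden_gt0//.
by rewrite gt_eqF ?ln2_gt0.
Qed.

(** Exponent [eta_dim] converts the binary scale of the values into the golden scale of the
    codes. *)
Lemma powR_half_dim m : (2 ^- m) `^ eta_dim = golden ^- m :> R.
Proof.
have g0 := ltW golden_gt0.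
by rewrite -(powR_invn m (ler0n R 2)) -powRrM mulrC powRrM powR2_dim powR_invn.
Qed.

Lemma size_words m : (size (words m))%:R <= golden ^+ m.
Proof.
suff h : forall m, (size (words m))%:R <= golden ^+ m /\
    (size (words m.+1))%:R <= golden ^+ m.+1 by exact: (h m).1.
move=> {m}; elim=> [|m [IH0 IH1]].
  by rewrite /= expr0 expr1 (ltW golden_gt1).
split=> //; rewrite words_rec size_cat !size_map natrD.
apply: le_trans (lerD IH1 IH0) _.
by rewrite exprS -{2}[golden ^+ m]mul1r -mulrDl -goldenE -exprD add2n.
Qed.

(* [golden_sum [:: k_1; ...; k_r]] is [sum_i golden^-(k_1 + ... + k_i)]. *)
Fixpoint golden_sum (w : seq nat) : R :=
  if w is k :: v then golden ^- k * (1 + golden_sum v) else 0.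

Lemma lo_rcons w k : golden_sum (rcons w k) = golden_sum w + golden ^- (sumn w + k).
Proof.
elim: w => [|l w IH] /=; first by rewrite addr0 mulr1 add0r.
by rewrite IH -addnA [golden ^+ (l + _)]exprD invfM; ring.
Qed.

(** With entries at least 2, the tail of an expansion is at most
    [sum_(i >= 1) golden^-(2i) = golden^-1] in relative size, whence the length of the interval. The
    left inequality is strict so that a positive remainder is always left to expand. *)
Definition coded (k : nat -> nat) (y : R) := forall r,
  golden_sum (mkseq k r) < y <= golden_sum (mkseq k r) + golden ^- (sumn (mkseq k r)).+1.

Lemma goldenV_lt1 : golden^-1 < 1.
Proof. by rewrite invf_lt1 ?golden_gt1 ?golden_gt0. Qed.

Lemma goldenX_le i j : (i <= j)%N -> golden ^- j <= golden ^- i.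
Proof.
move=> ij; have g0 := golden_gt0.
by rewrite lef_pV2 ?posrE ?exprn_gt0// ler_weXn2l// ltW// golden_gt1.
Qed.

Lemma goldenX_gt0 i : 0 < golden ^- i.
Proof. by rewrite invr_gt0 exprn_gt0// golden_gt0. Qed.

(** Makes the code intervals of consecutive entries abut: the upper end for [k+1] is the lower end
    for [k]. *)
Lemma goldenX_rec i : golden ^- i = golden ^- i.+1 + golden ^- i.+2.
Proof.
have g0 := lt0r_neq0 golden_gt0.
have gi : golden ^+ i != 0 by rewrite expf_neq0.
rewrite exprSr (_ : golden ^+ i.+2 = golden ^+ i * golden ^+ 2); last first.
  by rewrite -exprD addn2.
have -> : (golden ^+ i * golden)^-1 + (golden ^+ i * golden ^+ 2)^-1 =
          (golden + 1) / (golden ^+ i * golden ^+ 2) by field; exact/andP.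
by rewrite -goldenE; field; exact/andP.
Qed.

Lemma sumn_mkseq_ge k r : That k -> (r <= sumn (mkseq k r))%N.
Proof.
move=> hk; elim: r => // r IH; rewrite mkseqSr sumn_rcons -addn1.
by rewrite leq_add.
Qed.

Lemma coded_ex y : 0 < y <= golden ^- 1 -> exists2 k, That2 k & coded k y.
Proof.
move=> y01.
pose I w := all (leq 2) w /\ golden_sum w < y <= golden_sum w + golden ^- (sumn w).+1.
have [||k kP] := @nested_choice (fun _ _ => True) I.
- by split => //=; rewrite add0r.
- move=> w [w2 /andP[wy yw]]; set t := y - golden_sum w.
  have t0 : 0 < t by rewrite subr_gt0.
  have ex : exists k, (2 <= k)%N && (golden ^- (sumn w + k) < t).
    apply: contrapT => nex; have : t <= 0.
      apply: (@le_geometric _ _ _ 1 golden^-1).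
        by rewrite invr_ge0 ltW ?golden_gt0//= goldenV_lt1.
      move=> r; rewrite mul1r subr_le0 exprVn.
      have : t <= golden ^- (sumn w + r.+2).
        by rewrite leNgt; apply/negP => h; apply: nex; exists r.+2.
      move/le_trans; apply; apply: goldenX_le.
      by rewrite !addnS ltnW// ltnW// ltnS ltnS leq_addl.
    by rewrite leNgt t0.
  case: (ex_minnP ex) => k /andP[k2 kt] kmin.
  exists k; split => //; rewrite /I all_rcons k2 w2 lo_rcons sumn_rcons; split => //.
  rewrite -ltrBrDl kt /= -addrA -lerBlDl -/t.
  have -> : golden ^- (sumn w + k) + golden ^- (sumn w + k).+1 =
            golden ^- (sumn w + k.-1).
    rewrite [RHS]goldenX_rec (_ : (sumn w + k)%N = (sumn w + k.-1).+1)//.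
    by rewrite -addnS (ltn_predK k2).
  (* For [k = 2] the upper bound is inherited from the invariant; for larger [k] it is the
     minimality of [k]. *)
  have [k_le|k_gt] := leqP k 2.
    have -> : k = 2 by apply/eqP; rewrite eqn_leq k_le.
    by rewrite addn1 lerBlDl.
  rewrite leNgt; apply/negP => h; have := kmin k.-1.
  rewrite h andbT -ltnS (ltn_predK k2) => /(_ k_gt).
  by rewrite leqNgt ltn_predL (ltnW k2).
exists k => [i|r]; last by have [[]] := kP r.
by have [[+ _] _] := kP i.+1; rewrite mkseqSr all_rcons => /andP[].
Qed.

Lemma coded_inj k y y' : That k -> coded k y -> coded k y' -> y <= y'.
Proof.
move=> hk cy cy'; apply: (@le_geometric _ _ _ 1 golden^-1).
  by rewrite invr_ge0 ltW ?golden_gt0//= goldenV_lt1.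
move=> r; rewrite mul1r exprVn.
have /andP[h1 h2] := cy r; have /andP[h3 h4] := cy' r.
have : golden ^- (sumn (mkseq k r)).+1 <= golden ^- r.
  by apply: goldenX_le; rewrite ltnW// ltnS sumn_mkseq_ge.
lra.
Qed.

(** The code interval of entry [l r] lies below that of [k r], and both lie above the start of the
    common interval, from which [y] is at most [golden * golden^-N] away, [N] being the exponent on
    the right. *)
Lemma coded_dist k l y y' r : (forall i, (i < r)%N -> k i = l i) -> (k r < l r)%N ->
  coded k y -> coded l y' ->
  0 <= y - y' <= golden * golden ^- (sumn (mkseq k r) + k r).
Proof.
move=> kl klr cy cy'.
have kE : mkseq l r = mkseq k r.
  by apply/esym/eq_in_map => i; rewrite mem_iota => /kl.
have /andP[+ +] := cy r.+1; have /andP[+ +] := cy' r.+1; have /andP[+ _] := cy' r.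
rewrite !mkseqSr !lo_rcons !sumn_rcons kE.
set w := mkseq k r; set N := (sumn w + k r)%N.
have h1 : golden ^- (sumn w + l r) <= golden ^- N.+1.
  by apply: goldenX_le; rewrite -addnS leq_add2l.
have h2 : golden ^- (sumn w + l r).+1 <= golden ^- N.+2.
  by apply: goldenX_le; rewrite ltnS -addnS leq_add2l.
have h3 := goldenX_rec N.
have h4 : golden * golden ^- N = golden ^- N + golden ^- N.+1.
  rewrite exprS invfM -[X in X + _]mul1r -mulrDl; congr (_ * _).
  apply: (mulIf (lt0r_neq0 golden_gt0)).
  by rewrite mulrDl mul1r mulVf ?lt0r_neq0 ?golden_gt0// -expr2 goldenE.
rewrite h4; lra.
Qed.

End Golden.

(** * Lower and upper bounds for the Hausdorff dimension *)

Section Dimension.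
Context (R : realType) (n : nat) (n1 : (1 <= n)%N).
Local Notation Tval := (T_value R n).
Local Notation weight := (T_weight R n).
Local Notation eta := (eta_lim R n).
Local Notation A := (eta_lim R n @` That2).

(** With [N] the sum of the entries of the larger-valued sequence through the first difference, the
    codes differ by at most [golden * golden^-N], and the values by at least [2^-N / 12], by
    [eta_gap] and [weight1_ge]. *)
Lemma coded_holder k l y y' : That2 k -> That2 l -> coded k y -> coded l y' ->
  `|y - y'| <= golden R * 12 `^ eta_dim R * `|eta k - eta l| `^ eta_dim R.
Proof.
wlog kl : k l y y' / k = l \/ seq_succ k l.
  move=> wl hk hl cy cy'; have [e|e|e] := seq_succ_total k l.
  - by apply: wl => //; left.
  - by apply: wl => //; right.
  - by rewrite distrC [`|eta k - _|]distrC; apply: wl => //; right.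
move=> hk hl cy cy'; have hk' := That2_That hk.
case: kl => [e|[r [kl klr]]].
  rewrite -e in cy'; have -> : y = y'.
    by apply/eqP; rewrite eq_le !(coded_inj hk').
  by rewrite subrr normr0 !mulr_ge0 ?powR_ge0// ltW ?golden_gt0.
have /andP[yy0 yy1] := coded_dist kl klr cy cy'.
rewrite (ger0_norm yy0) (le_trans yy1)// -mulrA ler_wpM2l ?(ltW (golden_gt0 R))//.
rewrite -powRM// -powR_half_dim ge0_ler_powR ?(ltW (dim_gt0 R))// ?nnegrE.
- by rewrite invr_ge0 exprn_ge0.
- by rewrite mulr_ge0.
have gap := eta_gap R n1 hk' hl kl klr.
have h : 12^-1 * 2 ^- (sumn (mkseq k r) + k r) <=
    12^-1 * 2 ^- (k r) * weight (mkseq k r) 1.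
  rewrite -mulrA ler_wpM2l// addnC exprD invfM ler_wpM2l ?invr_ge0 ?exprn_ge0//.
  exact: weight1_ge.
have := ler_norm (eta k - eta l); lra.
Qed.

Lemma hausdorff_dim_ge s : 0 <= s -> hausdorff_measure s A = 0%E -> eta_dim R <= s.
Proof.
move=> s0 hs; rewrite leNgt; apply/negP => sd.
have D0 : 0 < golden R * 12 `^ eta_dim R by rewrite mulr_gt0 ?golden_gt0 ?powR_gt0.
have b0 : 0 < golden R ^- 1 by exact: goldenX_gt0.
pose C (y x : R) := exists k, [/\ That2 k, coded k y & eta k = x].
have := @hausdorff_premeasure_ge R C A s (eta_dim R) _ _ _ (dim_gt0 R) b0 D0.
rewrite s0 (ltW sd) => /(_ isT) h.
have {h} : ((golden R ^- 1 / (2 * (golden R * 12 `^ eta_dim R)))%:E 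
    <= hausdorff_premeasure s 1 A)%E.
  apply: h => [y /coded_ex[k hk cy]|y y' _ _ [k [hk cy <-]] [l [hl cy' <-]]].
    by exists (eta k); [exists k|exists k].
  exact: coded_holder.
apply/negP; rewrite -ltNge.
apply: (@le_lt_trans _ _ (hausdorff_measure s A)); last first.
  by rewrite hs lte_fin divr_gt0// mulr_gt0.
by apply: ereal_sup_ubound; exists 1 => //=.
Qed.

(** [w] is the longest prefix of sum at most [m]. The next entry brings the sum above [m], and
    [eta_le_digit] lets it count in the error. *)
Lemma eta_words k m : That2 k -> exists2 w, w \in words m &
  Tval w <= eta k <= Tval w + n.+1%:R * supeta R n ^+ 3 / 2 ^+ m.
Proof.
move=> hk; have hk' := That2_That hk.
have ex : exists r, (m < sumn (mkseq k r))%N by exists m.+1; exact: sumn_mkseq_ge.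
case: (ex_minnP ex) => -[//|r] rm rmin; set w := mkseq k r.
have wm : (sumn w <= m)%N.
  by rewrite leqNgt; apply/negP => /rmin; rewrite ltnn.
exists w; first by apply: mem_words => //; exact: all_mkseq.
rewrite Tval_le_eta//=; apply: le_trans (eta_le_digit R n r hk') _; rewrite -/w lerD2l.
have E0 := supeta_gt0 R n.
apply: le_trans (ler_wpM2r _ (weight1_le R n (That_all r hk'))) _.
  by rewrite divr_ge0 ?exprn_ge0// mulr_ge0// ltW.
have -> : supeta R n ^+ 2 / 2 ^+ sumn (mkseq k r) * (n.+1%:R * supeta R n / 2 ^+ k r) =
    n.+1%:R * supeta R n ^+ 3 / 2 ^+ (sumn w + k r).
  by rewrite exprD invfM -/w; ring.
rewrite ler_wpM2l ?mulr_ge0 ?exprn_ge0 ?(ltW E0)//.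
rewrite lef_pV2 ?posrE ?exprn_gt0// ler_weXn2l ?ler1n//.
by move: rm; rewrite mkseqSr sumn_rcons => /ltnW.
Qed.

(** At most [golden^m] intervals of length [c / 2^m] cover the set, so the total gauge is at most
    [c^s z^m], where [z = golden / 2^s < 1] since [s] exceeds [eta_dim]. *)
Lemma hausdorff_measure_eq0 s : eta_dim R < s -> hausdorff_measure s A = 0%E.
Proof.
move=> ds; have s0 : 0 <= s by rewrite ltW// (lt_trans (dim_gt0 R)).
pose c := n.+1%:R * supeta R n ^+ 3.
have c0 : 0 <= c by rewrite mulr_ge0// exprn_ge0// ltW// supeta_gt0.
pose z := golden R / 2 `^ s.
have z01 : 0 <= z < 1.
  rewrite divr_ge0 ?powR_ge0 ?(ltW (golden_gt0 R))//= ltr_pdivrMr ?powR_gt0// mul1r.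
  rewrite -powR2_dim /powR pnatr_eq0 /= ltr_expR ltr_pM2r// ln2_gt0//.
have bound m delta : c / 2 ^+ m <= delta ->
    (hausdorff_premeasure s delta A <= (c `^ s * z ^+ m)%:E)%E.
  move=> cd; have cm0 : 0 <= c / 2 ^+ m by rewrite divr_ge0// exprn_ge0.
  pose W i := nth [::] (words m) i.
  pose U i := `[Tval (W i), Tval (W i) + c / 2 ^+ m]%classic.
  apply: le_trans
    (@hausdorff_premeasure_le R s (c / 2 ^+ m) delta (size (words m)) U A s0 _ _ _) _.
  - by rewrite cm0.
  - move=> i _; apply: diameter_le => x y; rewrite /U /= !in_itv /=.
    move=> /andP[x1 x2] /andP[y1 y2].
    by rewrite ler_norml; apply/andP; split; lra.
  - move=> _ [k hk <-]; have [w wm /andP[w1 w2]] := eta_words m hk.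
    exists (index w (words m)); rewrite /= ?index_mem//.
    by rewrite /U /W nth_index// /= in_itv /= w1.
  rewrite lee_fin.
  apply: (@le_trans _ _ (golden R ^+ m * (c / 2 ^+ m) `^ s)).
    by rewrite ler_wpM2r ?powR_ge0// size_words.
  have -> : (c / 2 ^+ m) `^ s = c `^ s / (2 `^ s) ^+ m.
    rewrite powRM ?invr_ge0 ?exprn_ge0//; congr (_ * _).
    rewrite -(powR_invn m (ler0n R 2)) -powRrM mulrC powRrM.
    by rewrite powR_invn ?powR_ge0.
  by rewrite mulrCA -expr_div_n.
apply/eqP; rewrite eq_le; apply/andP; split; last first.
  apply: le_trans (hausdorff_premeasure_ge0 s 1 A) _.
  by apply: ereal_sup_ubound; exists 1 => //=.
apply: ge_ereal_sup => _ [delta /= delta0 <-].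
have [M Md] : exists M, forall m, c / 2 ^+ (M + m) <= delta.
  apply: contrapT => nex.
  have : delta <= 0.
    apply: (@le_geometric _ _ _ c 2^-1).
      by rewrite invr_ge0 ler0n /= invf_lt1// ltr1n.
    move=> r; rewrite subr_le0 exprVn leNgt; apply/negP => h; apply: nex; exists r => m.
    apply: le_trans (ltW h); rewrite ler_wpM2l// lef_pV2 ?posrE ?exprn_gt0//.
    by rewrite ler_weXn2l ?ler1n// leq_addr.
  by rewrite leNgt delta0.
have p0 := hausdorff_premeasure_ge0 s delta A.
have pfin : hausdorff_premeasure s delta A \is a fin_num.
  by rewrite ge0_fin_numE// (le_lt_trans (bound _ _ (Md 0%N))) ?ltry.
rewrite -(fineK pfin) lee_fin.
apply: (@le_geometric _ _ _ (c `^ s * z ^+ M) z z01) => r.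
rewrite subr_le0 -lee_fin (fineK pfin) -mulrA -exprD.
exact: bound.
Qed.

Lemma hausdorff_dim_eta : hausdorff_dim A = (eta_dim R)%:E.
Proof.
apply/eqP; rewrite eq_le; apply/andP; split; last first.
  apply: le_ereal_inf_tmp => _ [s [s0 hs] <-].
  by rewrite lee_fin hausdorff_dim_ge.
apply/lee_addgt0Pr => e e0; rewrite -EFinD.
apply: ereal_inf_lbound; exists (eta_dim R + e) => //; split.
  by rewrite addr_ge0 ?(ltW (dim_gt0 R))// ltW.
by apply: hausdorff_measure_eq0; rewrite ltrDl.
Qed.

End Dimension.

Theorem theorem1p1 (R : realType) (n : nat) (hn : (1 <= n)%N) :
  (forall k, That k -> cvgn (T_trunc R n k) /\ 1 < eta_lim R n k) /\
  (eta_lim R n @` (That `\` ThatR)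
     = `]1, expR (\sum_(1 <= j < n.+1) j%:R^-1)]%classic /\
   eta_lim R n @` ThatR
     `<=` `]1, expR (\sum_(1 <= j < n.+1) j%:R^-1)[%classic /\
   eta_lim R n (fun=> 1%N) = expR (\sum_(1 <= j < n.+1) j%:R^-1)) /\
  (forall k l, That2 k -> That2 l ->
     (eta_lim R n l < eta_lim R n k <-> seq_succ k l)) /\
  hausdorff_dim (eta_lim R n @` That2)
    = (ln ((1 + Num.sqrt 5) / 2) / ln 2)%:E.
Proof.
rewrite -supetaE; split; last split; last split.
- by move=> k hk; split; [exact: is_cvg_T_trunc|exact: eta_gt1].
- split; last split; last exact: eta_ones.
  + apply/seteqP; split=> [_ [k [hk _] <-]|y] /=; rewrite in_itv /=.
      by rewrite eta_gt1// eta_le_supeta.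
    by move=> /eta_greedy[//|k [hk nk <-]]; exists k.
  + move=> _ [k [hk [s [ks2 _]]] <-] /=; rewrite in_itv /= eta_gt1//.
    exact: eta_lt_supeta ks2.
- by move=> k l; exact: eta_ltE.
- exact: hausdorff_dim_eta.
Qed.
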